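(* Let $0<\alpha\le 1$. There is a generic set $\mathcal{G}_1\subseteq C^\alpha_0(\Sigma^+,\mathbb{R})$ (with respect to the $\alpha$-Hölder norm topology) such that if $A\in\mathcal{G}_1$ then $A$ has a unique maximizing measure, and the support of this measure is uniquely ergodic.
   Context: $\Sigma^+$ is a one-sided topologically mixing subshift of finite type (the sequences $\mathbf{x}=(x_0,x_1,\ldots)$ over a finite alphabet all of whose consecutive pairs $(x_i,x_{i+1})$ are allowed by a 0-1 transition matrix), with shift map $\sigma:\Sigma^+\to\Sigma^+$. Fix $\lambda>1$ and endow $\Sigma^+$ with the metric $d(\mathbf{x},\mathbf{y})=\lambda^{-n}$, $n=\min\{k\ge 0: x_k\ne y_k\}$ (and $d(\mathbf{x},\mathbf{x})=0$). For an exponent $\alpha$ write $\mathrm{Hold}_\alpha(A)=\sup_{0<d(x,y)\le 1}\frac{|A(x)-A(y)|}{d(x,y)^\alpha}$, $\|A\|_0=\sup_x|A(x)|$, $\|A\|_\alpha=\mathrm{Hold}_\alpha(A)+\|A\|_0$. $C^\alpha(\Sigma^+,\mathbb{R})$ is the space of $\alpha$-Hölder functions $A:\Sigma^+\to\mathbb{R}$ with norm $\|\cdot\|_\alpha$, and $C^\alpha_0(\Sigma^+,\mathbb{R})$ is the subset of those $A$ with topological pressure $P(A)=\max_\nu\big(h(\nu)+\int A\,d\nu\big)=0$, where $\nu$ ranges over $\sigma$-invariant Borel probabilities and $h(\nu)$ is the metric entropy, with the induced topology. A maximizing measure for $A$ is a $\sigma$-invariant Borel probability $\mu$ with $\int A\,d\mu=\max\{\int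 A\,d\nu:\nu\ \sigma\text{-invariant Borel probability}\}$. A set is generic if it contains a countable intersection of open dense subsets. A closed forward invariant set is uniquely ergodic if it supports exactly one $\sigma$-invariant Borel probability. *)

(* Defs.v *)
From HB Require Import structures.
From mathcomp Require Import all_boot all_order all_algebra.
From mathcomp Require Import all_classical all_reals all_analysis.
From mathcomp Require Import borel_hierarchy.
Set Implicit Arguments.
Unset Strict Implicit.
Unset Printing Implicit Defensive.
Import Order.TTheory GRing.Theory Num.Theory.
Import numFieldNormedType.Exports.
Local Open Scope classical_set_scope.
Local Open Scope ring_scope.

Definition topologically_mixing (T : topologicalType) (f : T -> T) :=
  forall U V : set T, open U -> open V -> U !=set0 -> V !=set0 ->
    exists N : nat, forall n, (N <= n)%N -> (iter n f @` U) `&` V !=set0.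

Definition generic_set (T : topologicalType) (G : set T) :=
  exists2 H : set T, Gdelta_dense H & H `<=` G.

Section HolderSpace.
Context {R : realType} {T : metricType R}.
Variable alpha : R.
Implicit Types A B : T -> R.

Definition holder_quotients A : set R :=
  [set q | exists x y, 0 < mdist x y <= 1 /\
                       q = `|A x - A y| / mdist x y `^ alpha].
Definition Hold A : R := sup (holder_quotients A).
Definition norm0 A : R := sup [set `|A x| | x in [set: T]].
Definition holder_norm A : R := Hold A + norm0 A.

(* Finiteness of both suprema in [holder_norm]. Boundedness of [A] is a
   separate clause because [T] is arbitrary; when [0 <= alpha] and the
   distance is at most 1 it follows from the first clause. *)
Definition is_holder : {pred (T -> R)} := mem [set A |
  has_ubound (holder_quotients A) /\ has_ubound [set `|A x| | x in [set: T]]].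

Lemma is_holderP A : reflect
  (has_ubound (holder_quotients A) /\ has_ubound [set `|A x| | x in [set: T]])
  (A \in is_holder).
Proof. by apply: (iffP idP); rewrite inE. Qed.

Lemma Hold_ub A x y : A \in is_holder -> 0 < mdist x y <= 1 ->
  `|A x - A y| / mdist x y `^ alpha <= Hold A.
Proof. by move=> /is_holderP[Ah _] xy; apply: ub_le_sup => //; exists x, y. Qed.

Lemma norm0_ub A x : A \in is_holder -> `|A x| <= norm0 A.
Proof. by move=> /is_holderP[_ Ab]; apply: ub_le_sup => //; exists x. Qed.

Lemma sup_le_nneg (E : set R) (b : R) : 0 <= b -> ubound E b -> sup E <= b.
Proof.
move=> b0 Eb; have [->|/set0P E0] := eqVneq E set0; first by rewrite sup0.
exact: ge_sup.
Qed.

Lemma Hold_ge0 A : A \in is_holder -> 0 <= Hold A.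
Proof.
move=> Ah; rewrite /Hold; have [->|/set0P[q Eq]] := eqVneq (holder_quotients A) set0.
  by rewrite sup0.
have [x [y [_ qE]]] := Eq.
apply: (@le_trans _ _ q); first by rewrite qE divr_ge0// powR_ge0.
by apply: ub_le_sup => //; move/is_holderP: Ah => -[].
Qed.

Lemma norm0_ge0 A : A \in is_holder -> 0 <= norm0 A.
Proof.
move=> Ah; rewrite /norm0.
have [->|/set0P[q Eq]] := eqVneq [set `|A x| | x in [set: T]] set0.
  by rewrite sup0.
have [x _ qE] := Eq.
apply: (@le_trans _ _ q); first by rewrite -qE.
by apply: ub_le_sup => //; move/is_holderP: Ah => -[].
Qed.

Lemma is_holder_submod : submod_closed is_holder.
Proof.
split.
  apply/is_holderP; split; exists 0.
    by move=> q [x [y [_ ->]]]; rewrite subrr normr0 mul0r.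
  by move=> q [x _ <-]; rewrite normr0.
move=> a A B Ah Bh; apply/is_holderP; split.
  exists (`|a| * Hold A + Hold B) => q [x [y [xy ->]]].
  have -> : (a *: A + B) x - (a *: A + B) y = a * (A x - A y) + (B x - B y).
    by rewrite !fctE /= /GRing.scale /= mulrBr addrACA opprD.
  apply: (@le_trans _ _ ((`|a| * `|A x - A y| + `|B x - B y|)
                         / mdist x y `^ alpha)).
    rewrite ler_wpM2r ?invr_ge0 ?powR_ge0//.
    by rewrite (le_trans (ler_normD _ _))// normrM.
  by rewrite mulrDl -mulrA lerD ?ler_wpM2l// Hold_ub.
exists (`|a| * norm0 A + norm0 B) => q [x _ <-].
rewrite !fctE /= (le_trans (ler_normD _ _))// /GRing.scale /= normrM.
by rewrite lerD ?ler_wpM2l// norm0_ub.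
Qed.

HB.instance Definition _ :=
  GRing.isSubmodClosed.Build R (T -> R) is_holder is_holder_submod.

(* The space C^alpha(T, R). *)
Record holder := Holder {
  holder_fun :> T -> R;
  holderP : holder_fun \in is_holder
}.

HB.instance Definition _ := [isSub for holder_fun].
HB.instance Definition _ := [Choice of holder by <:].
HB.instance Definition _ := [SubChoice_isSubLmodule of holder by <:].

Lemma holder_normD (A B : holder) :
  holder_norm (A + B : holder) <= holder_norm A + holder_norm B.
Proof.
rewrite /holder_norm addrACA lerD//; apply: sup_le_nneg.
- by rewrite addr_ge0// Hold_ge0// holderP.
- move=> q [x [y [xy ->]]]; rewrite /= !fctE opprD addrACA.
  apply: (le_trans (ler_wpM2r _ (ler_normD _ _))).
    by rewrite invr_ge0 powR_ge0.
  by rewrite mulrDl lerD// Hold_ub// holderP.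
- by rewrite addr_ge0// norm0_ge0// holderP.
- move=> q [x _ <-]; rewrite /= !fctE (le_trans (ler_normD _ _))//.
  by rewrite lerD// norm0_ub// holderP.
Qed.

Lemma holder_normZ_le (a : R) (A : holder) :
  holder_norm (a *: A : holder) <= `|a| * holder_norm A.
Proof.
rewrite /holder_norm mulrDr lerD//; apply: sup_le_nneg.
- by rewrite mulr_ge0// Hold_ge0// holderP.
- move=> q [x [y [xy ->]]]; rewrite /= !fctE /GRing.scale /= -mulrBr normrM.
  by rewrite -mulrA ler_wpM2l// Hold_ub// holderP.
- by rewrite mulr_ge0// norm0_ge0// holderP.
- move=> q [x _ <-]; rewrite /= !fctE /GRing.scale /= normrM.
  by rewrite ler_wpM2l// norm0_ub// holderP.
Qed.

Lemma holder_normr0_eq0 (A : holder) : holder_norm A = 0 -> A = 0.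
Proof.
move=> A0; apply/val_inj/funext => x /=; apply/eqP; rewrite -normr_le0.
rewrite (le_trans (norm0_ub x (holderP A)))// -A0 lerDr.
by rewrite Hold_ge0// holderP.
Qed.

Lemma holder_normZ (a : R) (A : holder) :
  holder_norm (a *: A : holder) = `|a| * holder_norm A.
Proof.
apply/eqP; rewrite eq_le holder_normZ_le andTb.
have [->|a0] := eqVneq a 0.
  rewrite normr0 mul0r; apply: addr_ge0.
    exact: Hold_ge0 (holderP _).
  exact: norm0_ge0 (holderP _).
rewrite mulrC -ler_pdivlMr ?normr_gt0// mulrC -normfV.
have := holder_normZ_le a^-1 (a *: A); rewrite scalerA mulVf// scale1r.
exact.
Qed.

HB.instance Definition _ := Lmodule_isNormed.Build R holder
  holder_normD holder_normZ holder_normr0_eq0.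

End HolderSpace.
Arguments holder {R} T alpha.

Section InvariantMeasures.
Context {d : measure_display} {T : measurableType d} {R : realType}.
Variable f : T -> T.
Implicit Types mu nu : probability T R.

Definition invariant mu :=
  forall B : set T, measurable B -> mu (f @^-1` B) = mu B.

(* A finite measurable partition is given by the labelling [c] of its cells
   (empty cells are harmless). *)
Definition finite_partition (J : finType) (c : T -> J) :=
  forall j, measurable (c @^-1` [set j]).

(* [ln 0 = 0], so null cells contribute 0. *)
Definition partition_entropy mu (J : finType) (c : T -> J) : R :=
  - \sum_(j : J) (let p := fine (mu (c @^-1` [set j])) in p * ln p).

(* The labelling of the join of the [f^-i c], [i < n]. *)
Definition join_partition (J : finType) (c : T -> J) (n : nat) :
    T -> {ffun 'I_n -> J} :=
  fun x => [ffun i : 'I_n => c (iter i f x)].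

Definition entropy_wrt mu (J : finType) (c : T -> J) : R :=
  limn (fun n : nat => partition_entropy mu (join_partition c n) / n%:R).

Definition metric_entropy mu : \bar R :=
  ereal_sup [set h | exists (k : nat) (c : T -> 'I_k),
                       finite_partition c /\ h = (entropy_wrt mu c)%:E].

(* On a subshift and for continuous [A] this supremum is attained, entropy
   being upper semicontinuous there: it is the maximum. *)
Definition pressure (A : T -> R) : \bar R :=
  ereal_sup [set (metric_entropy mu + \int[mu]_x (A x)%:E)%E
            | mu in [set mu : probability T R | invariant mu]].

Definition maximizing (A : T -> R) mu :=
  invariant mu /\
  forall nu, invariant nu ->
    (\int[nu]_x (A x)%:E <= \int[mu]_x (A x)%:E)%E.

(* As functions on all sets, two probabilities may differ outside the
   sigma-algebra; they are the same measure when they agree on it. *)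
Definition same_measure mu nu :=
  forall B : set T, measurable B -> mu B = nu B.

Definition exactly_one_measure (P : probability T R -> Prop) :=
  exists mu, P mu /\ forall nu, P nu -> same_measure nu mu.

End InvariantMeasures.

Section Subshift.
Context {R : realType} {S : finType} {M : rel S} {lam : R}.

Definition admissible (x : nat -> S) := forall i : nat, M (x i) (x i.+1).

(* The metric depends on [lam], and the measurable structure below requires a
   point, hence the two proofs carried by the type of points. *)
Record sft (lam_gt1 : 1 < lam) (ne : exists x, admissible x) := Sft {
  sft_seq :> nat -> S;
  sft_admissible : admissible sft_seq
}.

Context {lam_gt1 : 1 < lam} {ne : exists x, admissible x}.
Local Notation X := (sft lam_gt1 ne).

Lemma sft_eq (x y : X) : (forall i, x i = y i) -> x = y.
Proof.
case: x y => [x xP] [y yP] /= /funext xy; case: y / xy yP => yP.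
by rewrite (Prop_irrelevance xP yP).
Qed.

Definition sft_dist (x y : X) : R :=
  if pselect (exists k, x k != y k) is left h then lam ^- ex_minn h else 0.

Lemma lam_gt0 : 0 < lam. Proof. exact: lt_trans lam_gt1. Qed.

Lemma sft_distxx x : sft_dist x x = 0.
Proof. by rewrite /sft_dist; by case: pselect => // h; exfalso; case: h => k; rewrite eqxx. Qed.

Lemma sft_dist_positivity x y : sft_dist x y = 0 -> x = y.
Proof.
rewrite /sft_dist; case: pselect => [h /eqP|h _].
  by rewrite invr_eq0 expf_eq0 (gt_eqF lam_gt0) andbF.
by apply: sft_eq => i; apply/eqP; apply: contrapT => /negP xy; apply: h; exists i.
Qed.

Lemma sft_dist_sym x y : sft_dist x y = sft_dist y x.
Proof.
rewrite /sft_dist; case: pselect => h; case: pselect => h' //.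
- case: ex_minnP => m mP mm; case: ex_minnP => n nP nm.
  congr (_ ^- _); apply/eqP; rewrite eqn_leq.
  by apply/andP; split; [apply: mm|apply: nm]; rewrite eq_sym.
- by case: h'; case: h => k; rewrite eq_sym; exists k.
- by case: h; case: h' => k; rewrite eq_sym; exists k.
Qed.

Lemma sft_dist_ge0 x y : 0 <= sft_dist x y.
Proof.
by rewrite /sft_dist; case: pselect => // h; rewrite invr_ge0 exprn_ge0 ?ltW ?lam_gt0.
Qed.

Lemma sft_dist_le n (x y : X) : x n != y n -> lam ^- n <= sft_dist x y.
Proof.
move=> xy; rewrite /sft_dist; case: pselect => h; last by case: h; exists n.
case: ex_minnP => m _ /(_ _ xy) mn.
by rewrite lef_pV2 ?posrE ?exprn_gt0 ?lam_gt0// ler_weXn2l// ltW.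
Qed.

Lemma sft_dist_triangle (y x z : X) :
  sft_dist x z <= sft_dist x y + sft_dist y z.
Proof.
rewrite {1}/sft_dist; case: pselect => [h|_]; last first.
  by rewrite addr_ge0 ?sft_dist_ge0.
case: ex_minnP => n xz _; have [xy|xy] := eqVneq (x n) (y n).
  by rewrite (le_trans (@sft_dist_le n y z _)) -?xy// lerDr sft_dist_ge0.
by rewrite (le_trans (sft_dist_le xy))// lerDl sft_dist_ge0.
Qed.

HB.instance Definition _ := gen_eqMixin X.
HB.instance Definition _ := gen_choiceMixin X.
HB.instance Definition _ := isMetric.Build R X
  sft_distxx sft_dist_positivity sft_dist_sym sft_dist_triangle.
HB.instance Definition _ := isPointed.Build X (Sft lam_gt1 ne (projT2 (cid ne))).
HB.instance Definition _ := Measurable.copy X (g_sigma_algebraType (@open X)).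

Definition sft_shift (x : X) : X :=
  Sft lam_gt1 ne (fun i => sft_admissible x i.+1).

End Subshift.
Arguments admissible {S} M x.

Section SubshiftMeasures.
Context {R : realType} {S : finType} {M : rel S} {lam : R}.
Context {lam_gt1 : 1 < lam} {ne : exists x, admissible M x}.
Local Notation X := (sft lam_gt1 ne).
Implicit Types mu : probability X R.

Definition measure_support mu : set X :=
  [set x | forall U : set X, open U -> U x -> (0 < mu U)%E].

Definition uniquely_ergodic (K : set X) :=
  [/\ closed K, sft_shift @` K `<=` K &
      exactly_one_measure
        (fun mu : probability X R => invariant sft_shift mu /\ mu K = 1%E)].

(* The set C^alpha_0; as a type it carries the subspace topology. *)
Definition holder0 (alpha : R) : set (holder X alpha) :=
  [set A | pressure (sft_shift : X -> X) A = 0%E].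

End SubshiftMeasures.
Arguments holder0 {R S M lam} lam_gt1 ne alpha.

(* Main.v *)
Require Import Defs.
From HB Require Import structures.
From mathcomp Require Import all_boot all_order all_algebra.
From mathcomp Require Import all_classical all_reals all_analysis.
From mathcomp Require Import measurable_realfun ring lra.
Import Order.TTheory GRing.Theory Num.Theory.
Import numFieldNormedType.Exports.
Local Open Scope classical_set_scope.
Local Open Scope ring_scope.

(** Write [max_integral f] for the supremum of the integrals of [f] over the
    shift-invariant probabilities.

    The generic set.  Fix a set [B] of finite depth, that is, one that only
    constrains finitely many coordinates, and [e > 0].  Call [f] concentrated
    when all invariant measures whose integral is close enough to
    [max_integral f] give masses to [B] that differ by less than [e].  This is
    an open condition, because [max_integral] is 1-Lipschitz for the uniform
    norm ([concentrated_open]).  It is dense, because along the line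
    [f + t 1_B] the mass of [B] under near-maximizing measures is essentially
    nondecreasing in [t]: it plays the part of a subgradient of the convex
    function [t |-> max_integral (f + t 1_B)].  Each parameter at which
    concentration fails makes that mass gain [e], and the mass cannot exceed 1
    ([concentrated_dense]).  Adding a constant changes neither the near-maximizing
    measures nor the Hölder constant, and the pressure is 1-Lipschitz and
    commutes with the addition of constants, so a perturbed potential is brought
    back to zero pressure at a small cost ([pressure_normalize]).  There are
    countably many sets of finite depth, hence countably many conditions.

    One maximizing measure.  If [f] satisfies all of them, then along a
    maximizing sequence of invariant measures the mass of every set of finite
    depth converges.  The limit is finitely additive; sets of finite depth being
    compact and open, it extends to a probability
    ([finitely_additive_extension]), which is invariant and maximizing
    ([concentrated_exists]).  Two maximizing measures agree on all sets of finite
    depth, hence everywhere ([concentrated_unique]).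

    Unique ergodicity of the support.  A Hölder potential [f] has a continuous
    sub-action [V], with [f + V - V o shift <= max_integral f] everywhere
    ([sub_actionP]).  Integrating against a maximizing measure gives equality
    almost everywhere, hence on the whole support by continuity.  So every
    invariant measure carried by the support is maximizing
    ([support_maximizing]), and uniqueness applies to it. *)

Set Implicit Arguments.
Unset Strict Implicit.
Unset Printing Implicit Defensive.

(** * Sets of finite depth in a subshift *)

Section Cylinders.
Context {R : realType} {S : finType} {M : rel S} {lam : R}.
Context {lam_gt1 : 1 < lam} {ne : exists x, admissible M x}.
Local Notation X := (sft lam_gt1 ne).
Local Notation shift := (@sft_shift R S M lam lam_gt1 ne).
Implicit Types (x y z : X) (B : set X).

(** The relation [agree n] is the closed ball relation of radius [lam ^- n]; all
    the topology below is expressed through it. *)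
Definition agree n x y := forall i, (i < n)%N -> x i = y i.

Lemma agree_sym n x y : agree n x y -> agree n y x.
Proof. by move=> xy i /xy. Qed.

Lemma agree_trans n x y z : agree n x y -> agree n y z -> agree n x z.
Proof. by move=> xy yz i lin; rewrite xy// yz. Qed.

Lemma agree_le m n x y : (m <= n)%N -> agree n x y -> agree m x y.
Proof. by move=> mn xy i im; apply: xy; exact: leq_trans mn. Qed.

Lemma iter_shiftE k x i : iter k shift x i = x (k + i)%N.
Proof. by elim: k i => [|k IH] i //=; rewrite IH addSnnS. Qed.

Lemma mdist_agree n x y : agree n x y -> mdist x y <= lam ^- n.
Proof.
move=> xy; rewrite /mdist/= /sft_dist.
have l0 : 0 < lam by exact: lt_trans lam_gt1.
case: pselect => [h|_]; last by rewrite invr_ge0 exprn_ge0// ltW.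
case: ex_minnP => m xym _.
have nm : (n <= m)%N.
  by rewrite leqNgt; apply/negP => /xy xyE; rewrite xyE eqxx in xym.
by rewrite lef_pV2 ?posrE ?exprn_gt0// ler_weXn2l// ltW.
Qed.

(** The strict inequality gains one coordinate over [mdist_agree]: distances
    are powers of [lam]. *)
Lemma agree_mdist n x y : mdist x y < lam ^- n -> agree n.+1 x y.
Proof.
move=> xy i lin; apply/eqP; apply: contraT => xyi.
have l0 : 0 < lam by exact: lt_trans lam_gt1.
have := le_lt_trans (sft_dist_le xyi) xy.
rewrite ltf_pV2 ?posrE ?exprn_gt0// ltr_eXn2l//.
by rewrite ltnNge -ltnS lin.
Qed.

Lemma mdist_le1 x y : mdist x y <= 1.
Proof. by rewrite -(invr1 R) -(expr0 lam); apply: mdist_agree. Qed.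

Lemma lam_inv_small (e : R) : 0 < e -> exists n, lam ^- n < e.
Proof.
move=> e0; have l0 : 0 < lam by exact: lt_trans lam_gt1.
have : (fun n => lam^-1 ^+ n) @ \oo --> (0 : R).
  by apply: cvg_expr; rewrite ger0_norm ?invr_ge0 ?ltW// invf_lt1.
move=> /cvgrPdist_lt/(_ _ e0)[n _ /(_ n (leqnn n))] /=.
rewrite sub0r normrN ger0_norm ?exprn_ge0 ?invr_ge0 ?ltW// exprVn => h.
by exists n.
Qed.

Lemma nbhs_agree x (U : set X) :
  nbhs x U <-> exists n, forall y, agree n x y -> U y.
Proof.
split.
  move=> /nbhs_ballP[e /= e0 xU]; have [n small] := lam_inv_small e0.
  exists n => y xy; apply: xU; rewrite ballEmdist/=.
  exact: le_lt_trans (mdist_agree xy) small.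
have l0 : 0 < lam by exact: lt_trans lam_gt1.
move=> [n xU]; apply/nbhs_ballP; exists (lam ^- n) => /=.
  by rewrite invr_gt0 exprn_gt0.
move=> y; rewrite ballEmdist/= => /agree_mdist xy; apply: xU.
exact: agree_le xy.
Qed.

Lemma open_agree (U : set X) :
  open U <-> forall x, U x -> exists n, forall y, agree n x y -> U y.
Proof.
rewrite openE; split=> UU x Ux; first by apply/nbhs_agree; exact: UU.
by apply/nbhs_agree; exact: UU.
Qed.

Lemma continuous_shift : continuous shift.
Proof.
move=> x U /nbhs_agree[n xU]; apply/nbhs_agree; exists n.+1 => y xy.
by apply: xU => i lin; apply: xy.
Qed.

(** An ultrafilter selects one letter at each coordinate, the alphabet being
    finite; the resulting sequence is admissible because any two consecutive
    letters are read on some point, and it is the limit. *)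
Lemma compact_sft : compact [set: X].
Proof.
rewrite compact_ultra => F FU _.
have letter n : exists s, F [set x : X | x n = s].
  apply: contrapT => /forallNP nF.
  have : F [set x : X | forall s : S, ~ (x n = s)].
    apply: (@filter_forall _ _ (fun s (x : X) => ~ (x n = s))) => s.
    by have [/nF|] := in_ultra_setVsetC [set x : X | x n = s] FU.
  by move=> /filter_ex[x] /(_ (x n)); exact.
pose s n := projT1 (cid (letter n)).
have sF n : F [set x : X | forall i, (i < n)%N -> x i = s i].
  elim: n => [|n IH]; first by apply: filterS filterT.
  apply: filterS (filterI IH (projT2 (cid (letter n)))) => x [xs xn] i.
  by rewrite ltnS leq_eqVlt => /predU1P[->|/xs].
have sM : admissible M s.
  move=> i; have [x xs] := filter_ex (sF i.+2).
  by rewrite -!xs//; exact: sft_admissible.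
exists (Sft lam_gt1 ne sM); split=> // U /nbhs_agree[n sU].
by apply: filterS (sF n) => x xs; apply: sU => i lin; rewrite xs.
Qed.

Definition depth_set n B := forall x y, agree n x y -> B x -> B y.
Definition finite_depth B := exists n, depth_set n B.

Lemma finite_depth0 : finite_depth set0.
Proof. by exists 0%N. Qed.

Lemma finite_depthT : finite_depth setT.
Proof. by exists 0%N. Qed.

Lemma finite_depthC B : finite_depth B -> finite_depth (~` B).
Proof. by move=> [n Bn]; exists n => x y xy nBx /(Bn _ _ (agree_sym xy)). Qed.

Lemma finite_depthU B C : finite_depth B -> finite_depth C ->
  finite_depth (B `|` C).
Proof.
move=> [m Bm] [n Cn]; exists (maxn m n) => x y xy [Bx|Cx].
  by left; apply: Bm Bx; apply: agree_le xy; exact: leq_maxl.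
by right; apply: Cn Cx; apply: agree_le xy; exact: leq_maxr.
Qed.

Lemma finite_depth_shift B : finite_depth B -> finite_depth (shift @^-1` B).
Proof.
by move=> [n Bn]; exists n.+1 => x y xy; apply: Bn => i lin; exact: xy.
Qed.

Lemma finite_depth_open B : finite_depth B -> open B.
Proof. by move=> [n Bn]; apply/open_agree => x Bx; exists n => y /Bn; apply. Qed.

Lemma finite_depth_compact B : finite_depth B -> compact B.
Proof.
move=> Bf; apply: (subclosed_compact _ compact_sft) => //.
by rewrite -openC; apply/finite_depth_open/finite_depthC.
Qed.

Definition word n x : n.-tuple S := [tuple x i | i < n].

Lemma wordP n x y : reflect (agree n x y) (word n x == word n y).
Proof.
apply: (iffP eqP) => [xy i lin|xy]; last first.
  by apply: eq_from_tnth => i; rewrite !tnth_mktuple xy.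
have := congr1 (fun t => tnth t (Ordinal lin)) xy.
by rewrite !tnth_mktuple.
Qed.

Definition cylinder n (w : n.-tuple S) : set X := [set x | word n x = w].

(** The countably many codes [(n, D)] enumerate the sets of finite depth. *)
Definition code_set (c : {n : nat & {set n.-tuple S}}) : set X :=
  [set x | word (projT1 c) x \in projT2 c].

Lemma code_set_depth c : depth_set (projT1 c) (code_set c).
Proof. by case: c => n F x y /wordP/eqP; rewrite /code_set/= => ->. Qed.

Lemma depth_set_code n B : depth_set n B ->
  exists F : {set n.-tuple S}, B = code_set (existT _ n F).
Proof.
move=> Bn; exists [set w : n.-tuple S | `[< exists2 x, B x & word n x = w >]]%SET.
apply/seteqP; split => x; rewrite /code_set/= inE.
  by move=> Bx; apply/asboolP; exists x.
by move=> /asboolP[y By /eqP/wordP yx]; exact: Bn By.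
Qed.

Lemma agree_depth n x : depth_set n (agree n x).
Proof. by move=> y z yz xy; exact: agree_trans yz. Qed.

Lemma cylinder_depth n (w : n.-tuple S) : depth_set n (cylinder w).
Proof. by move=> x y /wordP/eqP; rewrite /cylinder/= => ->. Qed.

End Cylinders.

(** * Measures given by their values on sets of finite depth *)

Section FiniteDepthAlgebra.
Context {R : realType} {S : finType} {M : rel S} {lam : R}.
Context {lam_gt1 : 1 < lam} {ne : exists x, admissible M x}.
Local Notation X := (sft lam_gt1 ne).
Implicit Types B C : set X.

Lemma finite_depth_measurable B : finite_depth B -> measurable B.
Proof. by move=> /finite_depth_open; exact: sub_sigma_algebra. Qed.

Lemma open_sft_measurable B : open B -> measurable B.
Proof. exact: sub_sigma_algebra. Qed.

(** The cylinders are countably many, so that a property shared by small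
    enough cylinders around each point of [W] is shared by the members of a
    countable cover of [W]. *)
Lemma countable_depth_cover (P : set (set X)) (W : set X) : P set0 ->
  (forall x, W x -> exists n, P (agree n x)) ->
  exists F : nat -> set X,
    (forall k, finite_depth (F k) /\ P (F k)) /\ W `<=` \bigcup_k F k.
Proof.
move=> P0 WP.
pose F k : set X :=
  if (unpickle k : option {n : nat & {set n.-tuple S}}) is Some c
  then (if `[< P (code_set c) >] then code_set c else set0) else set0.
exists F; split=> [k|x /WP[n Pn]].
  rewrite /F; case: unpickle => [c|]; last by split; [exact: finite_depth0|].
  case: ifPn => [/asboolP Pc|_]; last by split; [exact: finite_depth0|].
  by split=> //; exists (projT1 c); exact: code_set_depth.
have [D Dc] := depth_set_code (@agree_depth _ _ _ _ _ _ n x).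
exists (pickle (existT _ n D : {n : nat & {set n.-tuple S}})) => //.
by rewrite /F pickleK -Dc ifT//; exact/asboolP.
Qed.

Lemma open_bigcup_depth (U : set X) : open U ->
  exists F : nat -> set X, (forall k, finite_depth (F k)) /\ U = \bigcup_k F k.
Proof.
move=> /open_agree oU.
have [||F [FU UF]] := @countable_depth_cover [set B | B `<=` U] U.
- exact: sub0set.
- by move=> x /oU.
exists F; split=> [k|]; first exact: (FU k).1.
apply/seteqP; split=> // x [k _]; exact: (FU k).2.
Qed.

(** Every open set is a countable union of sets of finite depth. *)
Lemma measurable_finite_depthE :
  (@measurable _ X) = <<s [set B | finite_depth B] >>.
Proof.
apply/seteqP; split; last first.
  apply: smallest_sub; first exact: sigma_algebra_measurable.
  exact: finite_depth_measurable.
apply: smallest_sub; first exact: smallest_sigma_algebra.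
move=> U /open_bigcup_depth[F [Ff ->]].
apply: sigma_algebra_bigcup => k.
exact: sub_sigma_algebra (Ff k).
Qed.

Lemma eq_on_finite_depth (mu nu : {measure set X -> \bar R}) :
  (mu setT < +oo)%E -> (forall B, finite_depth B -> mu B = nu B) ->
  forall B, measurable B -> mu B = nu B.
Proof.
move=> mufin munu; apply: (measure_unique [set B | finite_depth B] (fun=> setT)).
- exact: measurable_finite_depthE.
- move=> B C; rewrite -[B `&` C]setCK setCI => /finite_depthC Bf /finite_depthC Cf.
  exact/finite_depthC/finite_depthU.
- by move=> _; exact: finite_depthT.
- by rewrite bigcup_const//; exists 0%N.
- exact: munu.
- by move=> _; exact: mufin.
Qed.

(** A copy of the space whose measurable sets are the sets of finite depth, so
    that a finitely additive function on these sets is a content and the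
    extension theorem for measures applies. *)
Definition clopen_alg := X.
HB.instance Definition _ := Pointed.on clopen_alg.
Definition clopen_display : measure_display. Proof. exact. Qed.
HB.instance Definition _ := @isAlgebraOfSets.Build clopen_display clopen_alg
  [set B | finite_depth B] finite_depth0 (@finite_depthU _ _ _ _ _ _)
  (@finite_depthC _ _ _ _ _ _).

Section Extension.
Variable p : set X -> R.
Hypothesis p_ge0 : forall B, 0 <= p B.
Hypothesis pU : forall B C, finite_depth B -> finite_depth C ->
  [disjoint B & C] -> p (B `|` C) = p B + p C.
Hypothesis pT : p setT = 1.

Let p0 : p set0 = 0.
Proof.
have := pU finite_depth0 finite_depth0; rewrite disj_set2E setI0 eqxx => /(_ isT).
by rewrite setU0 => /eqP; rewrite -subr_eq subrr eq_sym => /eqP.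
Qed.

Definition clopen_content (B : set clopen_alg) : \bar R := (p B)%:E.

Let content_ge0 B : (0 <= clopen_content B)%E.
Proof. by rewrite lee_fin. Qed.

Let content_additive : measure_function.semi_additive clopen_content.
Proof.
apply/additive2P; first by rewrite /clopen_content p0.
move=> B C Bf Cf BC; rewrite /clopen_content -EFinD pU//; exact/disj_set2P.
Qed.

HB.instance Definition _ := isContent.Build _ _ _ clopen_content
  content_ge0 content_additive.

(** Sets of finite depth are both compact and open, so a countable cover has a
    finite subcover and finite subadditivity is enough. *)
Let content_sigma_subadditive :
  measurable_subset_sigma_subadditive clopen_content.
Proof.
move=> A F Ff Af AF.
have := finite_depth_compact Af; rewrite compact_cover => /(_ _ setT F).
case=> [i _|x /AF[i _ Fix]|D _ AD]; first exact: finite_depth_open (Ff i).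
  by exists i.
pose n := (\max_(i <- finmap.enum_fset D) i).+1.
apply: (le_trans _ (@nneseries_lim_ge _ _ xpredT 0%N n _)); last first.
  by move=> i _ _; exact: content_ge0.
rewrite big_mkord.
apply: (@content_subadditive _ _ _ clopen_content A F n) => // x /AD[i /= Di Fix].
rewrite -bigcup_mkord; exists i => //=.
rewrite ltnS; exact: (@leq_bigmax_seq _ _ xpredT id).
Qed.

HB.instance Definition _ := Content_SigmaSubAdditive_isMeasure.Build _ _ _
  clopen_content content_sigma_subadditive.

(** The measure lives on the sigma-algebra generated by the sets of finite
    depth, which is the Borel one; it is transported to the original type. *)
Definition extension (B : set X) : \bar R := measure_extension clopen_content B.

Let extension0 : extension set0 = 0%E.
Proof. exact: (measure0 (measure_extension clopen_content)). Qed.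

Let extension_ge0 B : (0 <= extension B)%E.
Proof. exact: (measure_ge0 (measure_extension clopen_content)). Qed.

Let extension_sigma_additive : semi_sigma_additive extension.
Proof.
move=> F Fm Ft UFm.
apply: (@measure_semi_sigma_additive _ _ _ (measure_extension clopen_content) F).
- by move=> i; have := Fm i; rewrite measurable_finite_depthE.
- exact: Ft.
- by move: UFm; rewrite measurable_finite_depthE.
Qed.

HB.instance Definition _ := isMeasure.Build _ _ _ extension
  extension0 extension_ge0 extension_sigma_additive.

Lemma extensionE B : finite_depth B -> extension B = (p B)%:E.
Proof.
by move=> Bf; rewrite /extension /measure_extension measurable_mu_extE.
Qed.

Let extensionT : extension setT = 1%E.
Proof. by rewrite extensionE ?pT//; exact: finite_depthT. Qed.

HB.instance Definition _ := Measure_isProbability.Build _ _ _ extension extensionT.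

Definition extension_probability : probability X R := extension.

End Extension.

(** Kolmogorov extension on a subshift: consistent masses of cylinders define a
    measure. *)
Lemma finitely_additive_extension (p : set X -> R) :
  (forall B, finite_depth B -> 0 <= p B) ->
  (forall B C, finite_depth B -> finite_depth C ->
    [disjoint B & C] -> p (B `|` C) = p B + p C) ->
  p setT = 1 ->
  exists mu : probability X R, forall B, finite_depth B -> mu B = (p B)%:E.
Proof.
move=> p0 pU pT.
(* The extension is built from a function that is nonnegative on all sets. *)
pose q B := if `[< finite_depth B >] then p B else 0.
have qE B : finite_depth B -> q B = p B by move=> Bf; rewrite /q ifT//; exact/asboolP.
have q0 B : 0 <= q B by rewrite /q; case: ifPn => // /asboolP; exact: p0.
have qU B C : finite_depth B -> finite_depth C -> [disjoint B & C] ->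
    q (B `|` C) = q B + q C.
  by move=> Bf Cf BC; rewrite !qE//; [exact: pU|exact: finite_depthU].
have qT : q setT = 1 by rewrite qE//; exact: finite_depthT.
exists (extension_probability q0 qU qT) => B Bf /=.
by rewrite extensionE// qE.
Qed.

End FiniteDepthAlgebra.

(** * Continuous functions and their integrals *)

Section DepthContinuous.
Context {R : realType} {S : finType} {M : rel S} {lam : R}.
Context {lam_gt1 : 1 < lam} {ne : exists x, admissible M x}.
Local Notation X := (sft lam_gt1 ne).
Local Notation shift := (@sft_shift R S M lam lam_gt1 ne).
Implicit Types (B C : set X) (f g : X -> R) (mu nu : probability X R).

(** Uniform continuity, which is continuity since the space is compact. *)
Definition depth_continuous f :=
  forall e, 0 < e -> exists n, forall x y, agree n x y -> `|f x - f y| <= e.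

Lemma depth_continuous_cst c : depth_continuous (fun=> c).
Proof. by move=> e e0; exists 0%N => x y _; rewrite subrr normr0 ltW. Qed.

Lemma depth_continuousD f g : depth_continuous f -> depth_continuous g ->
  depth_continuous (fun x => f x + g x).
Proof.
move=> fc gc e e0; have e20 : 0 < e / 2 by rewrite divr_gt0.
have [m fm] := fc _ e20; have [n gn] := gc _ e20.
exists (maxn m n) => x y xy; rewrite opprD addrACA [leRHS]splitr.
rewrite (le_trans (ler_normD _ _))// lerD//.
  by apply: fm; apply: agree_le xy; exact: leq_maxl.
by apply: gn; apply: agree_le xy; exact: leq_maxr.
Qed.

Lemma depth_continuousZ c f : depth_continuous f ->
  depth_continuous (fun x => c * f x).
Proof.
move=> fc e e0; have c0 : 0 < `|c| + 1 by rewrite ltr_wpDl.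
have [n fn] := fc (e / (`|c| + 1)) (divr_gt0 e0 c0).
exists n => x y /fn xy; rewrite -mulrBr normrM.
apply: (@le_trans _ _ (`|c| * (e / (`|c| + 1)))); first by rewrite ler_wpM2l.
by rewrite mulrCA ler_piMr ?ltW// ltr_pdivrMr// mul1r ltrDl.
Qed.

Lemma depth_continuousN f : depth_continuous f ->
  depth_continuous (fun x => - f x).
Proof.
by move=> fc e /fc[n fn]; exists n => x y /fn xy; rewrite -opprD normrN.
Qed.

Lemma depth_continuousB f g : depth_continuous f -> depth_continuous g ->
  depth_continuous (fun x => f x - g x).
Proof. by move=> fc gc; apply: depth_continuousD => //; exact: depth_continuousN. Qed.

Lemma depth_continuous_indic B : finite_depth B ->
  depth_continuous (\1_B : X -> R).
Proof.
move=> [n Bn] e e0; exists n => x y xy.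
rewrite !indicE; have -> : (x \in B) = (y \in B).
  by apply/idP/idP; rewrite !inE; apply: Bn => //; exact: agree_sym.
by rewrite subrr normr0 ltW.
Qed.

Lemma depth_continuous_shift f : depth_continuous f ->
  depth_continuous (f \o shift).
Proof.
move=> fc e /fc[n fn]; exists n.+1 => x y xy; apply: fn => i lin.
exact: xy.
Qed.

Lemma depth_continuous_open f c : depth_continuous f ->
  open [set x | c < f x].
Proof.
move=> fc; apply/open_agree => x /= cx.
have [|n fn] := fc ((f x - c) / 2); first by rewrite divr_gt0// subr_gt0.
exists n => y /fn; rewrite ler_distl => /andP[_ h] /=; lra.
Qed.

Lemma depth_continuous_measurable f : depth_continuous f ->
  measurable_fun [set: X] f.
Proof.
move=> fc; apply: (measurability _ (RGenOInfty.measurableE R)) => //.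
move=> _ [_ [c ->] <-]; rewrite setTI; apply: open_sft_measurable.
have -> : f @^-1` `]c, +oo[ = [set x | c < f x].
  by apply/seteqP; split=> x /=; rewrite in_itv/= andbT.
exact: depth_continuous_open.
Qed.

(** Words read on no point get the value 0, which no evaluation meets. *)
Definition word_value n f (w : n.-tuple S) : R :=
  if pselect (exists x : X, word n x = w) is left h then f (projT1 (cid h)) else 0.

Lemma word_valueP n f x : exists2 y, agree n x y & word_value f (word n x) = f y.
Proof.
rewrite /word_value; case: pselect => [h|[]]; last by exists x.
by case: cid => y /= yx; exists y => //; apply/wordP; rewrite yx.
Qed.

(** Up to 1, the function takes the finitely many values [word_value f w]. *)
Lemma depth_continuous_bounded f : depth_continuous f ->
  exists K, forall x, `|f x| <= K.
Proof.
move=> /(_ 1 ltr01)[n fn].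
exists (\sum_(w : n.-tuple S) `|word_value f w| + 1) => x.
have [y xy fy] := word_valueP n f x.
have -> : f x = word_value f (word n x) + (f x - f y) by rewrite fy addrC subrK.
rewrite (le_trans (ler_normD _ _))// lerD//; last exact: fn.
by rewrite (bigD1 (word n x))//= lerDl sumr_ge0.
Qed.

Lemma depth_continuous_integrable mu f : depth_continuous f ->
  mu.-integrable setT (EFin \o f).
Proof.
move=> fc; apply: measurable_bounded_integrable => //.
- by rewrite [ltLHS]probability_setT ltey.
- exact: depth_continuous_measurable.
- have [K fK] := depth_continuous_bounded fc.
  exists K; split; first exact: num_real.
  by move=> K' /ltW KK' x _ /=; exact: le_trans KK'.
Qed.

Lemma integral_EFin mu f : depth_continuous f ->
  (\int[mu]_x (f x)%:E = (\int[mu]_x f x)%:E)%E.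
Proof.
move=> fc; rewrite fineK//; apply: integrable_fin_num => //.
exact: depth_continuous_integrable.
Qed.

Lemma Rintegral_indic mu B : measurable B ->
  \int[mu]_x (\1_B x) = fine (mu B).
Proof. by move=> mB; rewrite /Rintegral integral_indic// setIT. Qed.

Lemma Rintegral_cst1 mu c : \int[mu]_x c = c.
Proof. by rewrite Rintegral_cst// [X in fine X]probability_setT mulr1. Qed.

Lemma Rintegral_dist mu f g e : depth_continuous f -> depth_continuous g ->
  (forall x, `|f x - g x| <= e) -> `|\int[mu]_x f x - \int[mu]_x g x| <= e.
Proof.
move=> fc gc fg.
have fi := depth_continuous_integrable mu fc.
have gi := depth_continuous_integrable mu gc.
have ei := depth_continuous_integrable mu (depth_continuous_cst e).
have hi := depth_continuous_integrable mu (depth_continuousB fc gc).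
rewrite -RintegralB// ler_norml; apply/andP; split.
  rewrite -(Rintegral_cst1 mu (- e)); apply: le_Rintegral => //.
    exact/depth_continuous_integrable/depth_continuous_cst.
  by move=> x _; have := fg x; rewrite ler_norml => /andP[].
rewrite -[leRHS](Rintegral_cst1 mu e); apply: le_Rintegral => //.
by move=> x _; have := fg x; rewrite ler_norml => /andP[].
Qed.

(** The approximation of [f] by a function of the first [n] coordinates. *)
Definition step_fun n f (x : X) := word_value f (word n x).

Lemma step_funE n f x :
  step_fun n f x = \sum_(w : n.-tuple S) word_value f w * \1_(cylinder w : set X) x.
Proof.
rewrite (bigD1 (word n x))//= big1 ?addr0.
  by rewrite indicE /step_fun mem_set// mulr1.
move=> w wx; rewrite indicE memNset ?mulr0// /cylinder/= => xw.
by rewrite xw eqxx in wx.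
Qed.

Lemma depth_continuous_step n f : depth_continuous (step_fun n f).
Proof.
move=> e e0; exists n => x y /wordP/eqP xy.
by rewrite /step_fun xy subrr normr0 ltW.
Qed.

Lemma step_fun_dist n f e : (forall x y, agree n x y -> `|f x - f y| <= e) ->
  forall x, `|f x - step_fun n f x| <= e.
Proof.
by move=> fn x; rewrite /step_fun; have [y xy ->] := word_valueP n f x; exact: fn.
Qed.

Lemma Rintegral_step n f mu : \int[mu]_x step_fun n f x =
  \sum_(w : n.-tuple S) word_value f w * fine (mu (cylinder w)).
Proof.
under eq_Rintegral do rewrite step_funE.
pose F (w : n.-tuple S) : X -> R := fun x => word_value f w * \1_(cylinder w : set X) x.
have Fd w : depth_continuous (F w).
  apply/depth_continuousZ/depth_continuous_indic; exists n; exact: cylinder_depth.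
have H (s : seq (n.-tuple S)) : depth_continuous (fun x => \sum_(w <- s) F w x) /\
    \int[mu]_x (\sum_(w <- s) F w x) =
    \sum_(w <- s) word_value f w * fine (mu (cylinder w)).
  elim: s => [|w s [sd IH]].
    split; first by under eq_fun do rewrite big_nil; exact: depth_continuous_cst.
    by under eq_Rintegral do rewrite big_nil; rewrite big_nil Rintegral_cst1.
  split; first by under eq_fun do rewrite big_cons; exact: depth_continuousD.
  under eq_Rintegral do rewrite big_cons.
  rewrite RintegralD//; try exact: depth_continuous_integrable.
  rewrite IH big_cons; congr +%R.
  have cf : finite_depth (cylinder w : set X) by exists n; exact: cylinder_depth.
  rewrite /F RintegralZl// ?Rintegral_indic//.
    exact: finite_depth_measurable.
  exact/depth_continuous_integrable/depth_continuous_indic.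
exact: (H _).2.
Qed.

(** Convergence of the masses of sets of finite depth is weak convergence of
    measures: integrals of step functions converge, and these approximate [f]
    uniformly with respect to all the measures at once. *)
Lemma cvg_Rintegral (nu : nat -> probability X R) mu f : depth_continuous f ->
  (forall B, finite_depth B ->
    (fun k => fine (nu k B)) @ \oo --> fine (mu B)) ->
  (fun k => \int[nu k]_x f x) @ \oo --> \int[mu]_x f x.
Proof.
move=> fc numu; apply/cvgrPdist_le => e e0.
have e40 : 0 < e / 4 by rewrite divr_gt0.
have [n fn] := fc _ e40.
have sd := step_fun_dist fn.
have stc := depth_continuous_step n f.
have : (fun k => \int[nu k]_x step_fun n f x) @ \oo --> \int[mu]_x step_fun n f x.
  rewrite Rintegral_step; under eq_fun do rewrite Rintegral_step.
  apply: cvg_big => [|w _]; first exact: add_continuous.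
  by apply: cvgMl_tmp; apply: numu; exists n; exact: cylinder_depth.
move=> /cvgrPdist_le/(_ _ e40); apply: filter_app; near=> k.
have := Rintegral_dist mu fc stc sd.
have := Rintegral_dist (nu k) fc stc sd.
rewrite !ler_norml => /andP[h1 h2] /andP[h3 h4] /andP[h5 h6].
by apply/andP; split; lra.
Unshelve. all: by end_near. Qed.

Lemma measurable_shift : measurable_fun [set: X] shift.
Proof.
apply: (measurability _ (erefl : @measurable _ X = <<s @open X >>)) => //.
move=> _ [U oU <-]; rewrite setTI; apply: open_sft_measurable.
by apply: open_comp => // x _; exact: continuous_shift.
Qed.

Lemma Rintegral_shift mu f : depth_continuous f -> Defs.invariant shift mu ->
  \int[mu]_x f (shift x) = \int[mu]_x f x.
Proof.
move=> fc mui; rewrite /Rintegral; congr fine.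
have fm : measurable_fun setT (EFin \o f).
  by apply/measurable_EFinP; exact: depth_continuous_measurable.
have := @integral_pushforward _ _ X X R shift measurable_shift mu setT _ fm.
rewrite preimage_setT => <-//; last first.
  exact: (depth_continuous_integrable mu (depth_continuous_shift fc)).
apply: eq_measure_integral; first exact: measurable_shift.
by move=> mS B mB _; exact: mui.
Qed.

End DepthContinuous.

(** * Maximizing measures and their supports *)

Section Maximization.
Context {R : realType} {S : finType} {M : rel S} {lam : R}.
Context {lam_gt1 : 1 < lam} {ne : exists x, admissible M x}.
Local Notation X := (sft lam_gt1 ne).
Local Notation shift := (@sft_shift R S M lam lam_gt1 ne).
Local Notation invariant := (Defs.invariant shift).
Implicit Types (B C : set X) (f g : X -> R) (mu nu : probability X R).

Lemma fine_additive mu B C : finite_depth B -> finite_depth C ->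
  [disjoint B & C] -> fine (mu (B `|` C)) = fine (mu B) + fine (mu C).
Proof.
move=> /finite_depth_measurable mB /finite_depth_measurable mC /disj_set2P BC.
by rewrite measureU// fineD//; exact: fin_num_measure.
Qed.

(** The measure and its push-forward by the shift agree on a generating
    algebra. *)
Lemma finite_depth_invariant mu :
  (forall B, finite_depth B -> mu (shift @^-1` B) = mu B) -> invariant mu.
Proof.
move=> muB B mB; symmetry.
apply: (@eq_on_finite_depth _ _ _ _ _ _ mu (pushforward mu shift)) => //.
- exact: measurable_shift.
- by rewrite [ltLHS]probability_setT ltey.
- by move=> mS C Cf; exact: esym (muB C Cf).
Qed.

Definition max_integral f : R :=
  sup [set \int[mu]_x f x | mu in [set mu : probability X R | invariant mu]].

Lemma le_max_integral f mu : depth_continuous f -> invariant mu ->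
  \int[mu]_x f x <= max_integral f.
Proof.
move=> fc mui; apply: ub_le_sup; last by exists mu.
have [K fK] := depth_continuous_bounded fc.
exists K => _ [nu _ <-]; rewrite -(Rintegral_cst1 nu K).
apply: le_Rintegral => //.
- exact: depth_continuous_integrable.
- exact/depth_continuous_integrable/depth_continuous_cst.
- by move=> x _; rewrite (le_trans (ler_norm _)).
Qed.

Definition near_maximizing f d mu :=
  invariant mu /\ max_integral f - d < \int[mu]_x f x.

Lemma near_maximizingP f d : depth_continuous f -> 0 < d ->
  (exists mu : probability X R, invariant mu) ->
  exists mu, near_maximizing f d mu.
Proof.
move=> fc d0 [mu0 mu0i].
have : has_sup [set \int[mu]_x f x | mu in [set mu : probability X R | invariant mu]].
  split; first by exists (\int[mu0]_x f x), mu0.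
  by exists (max_integral f) => _ [nu nui <-]; exact: le_max_integral.
by move=> /(sup_adherent d0)[_ [mu mui <-] h]; exists mu.
Qed.

Lemma maximizingP f mu : depth_continuous f ->
  maximizing shift f mu <-> invariant mu /\ \int[mu]_x f x = max_integral f.
Proof.
move=> fc; split=> [[mui mumax]|[mui mumax]]; split=> //.
  apply/eqP; rewrite eq_le le_max_integral//=.
  apply: ge_sup; first by exists (\int[mu]_x f x), mu.
  by move=> _ [nu nui <-]; rewrite -lee_fin -!integral_EFin//; exact: mumax.
by move=> nu nui; rewrite !integral_EFin// lee_fin mumax le_max_integral.
Qed.

(** Quantifying over near-maximizing measures rather than maximizing ones gives
    room for perturbations of [f], and makes the masses of [B] along maximizing
    sequences Cauchy. *)
Definition concentrated f B e := exists2 d, 0 < d &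
  forall mu nu, near_maximizing f d mu -> near_maximizing f d nu ->
    `|fine (mu B) - fine (nu B)| < e.

Lemma near_maximizing_le f d d' mu : d <= d' ->
  near_maximizing f d mu -> near_maximizing f d' mu.
Proof.
by move=> dd' [mui h]; split => //; apply: le_lt_trans h; rewrite lerB.
Qed.

Lemma maximizing_near f d mu : depth_continuous f -> 0 < d ->
  maximizing shift f mu -> near_maximizing f d mu.
Proof.
move=> fc d0 /(maximizingP _ fc)[mui mumax]; split=> //.
by rewrite mumax ltrBlDr ltrDl.
Qed.

Lemma concentrated_unique f mu nu : depth_continuous f ->
  (forall B e, finite_depth B -> 0 < e -> concentrated f B e) ->
  maximizing shift f mu -> maximizing shift f nu -> same_measure mu nu.
Proof.
move=> fc fconc mumax numax; apply: eq_on_finite_depth.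
  by rewrite [ltLHS]probability_setT ltey.
move=> B Bf; have mB := finite_depth_measurable Bf.
have munu : fine (mu B) = fine (nu B).
  apply/eqP; rewrite -subr_eq0 -normr_le0; apply/ler_addgt0Pl => e e0.
  rewrite addr0; have [d d0 h] := fconc B e Bf e0.
  by apply/ltW/h; exact: maximizing_near.
by have := congr1 EFin munu; rewrite !fineK//; exact: fin_num_measure.
Qed.

(** A maximizing sequence is Cauchy on each set of finite depth, so its limit
    masses exist and define the maximizing measure. *)
Lemma concentrated_exists f : depth_continuous f ->
  (exists mu : probability X R, invariant mu) ->
  (forall B e, finite_depth B -> 0 < e -> concentrated f B e) ->
  exists mu, maximizing shift f mu.
Proof.
move=> fc exi fconc.
have /choice[nu nuP] k : exists mu, near_maximizing f (k.+1%:R^-1) mu.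
  by apply: near_maximizingP => //; rewrite invr_gt0.
have near_nu d : 0 < d -> \forall k \near \oo, near_maximizing f d (nu k).
  move=> d0; have /cvgrPdist_lt/(_ d d0) := @cvg_harmonic R.
  apply: filterS => k /=; rewrite sub0r normrN ger0_norm// => kd.
  exact: near_maximizing_le (ltW kd) (nuP k).
pose p B := limn (fun k => fine (nu k B)).
have cvg_nu B : finite_depth B -> (fun k => fine (nu k B)) @ \oo --> p B.
  move=> Bf; apply/cauchy_cvgP/cauchy_exP => e e0.
  have [d d0 h] := fconc B e Bf e0.
  have [N _ dN] := near_nu d d0.
  exists (fine (nu N B)); exists N => // k /= Nk.
  by apply: h; apply: dN => /=.
have [||| mu muE] := @finitely_additive_extension R S M lam lam_gt1 ne p.
- move=> B Bf; apply: limr_ge; first by apply: cvgP; exact: cvg_nu Bf.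
  by apply: nearW => k; exact: fine_ge0.
- move=> B C Bf Cf BC; apply/cvg_lim => //.
  under eq_fun do rewrite fine_additive//.
  by apply: cvgD; exact: cvg_nu.
- apply/cvg_lim => //; under eq_fun do rewrite [X in fine X]probability_setT.
  exact: cvg_cst.
have cvg_mu B : finite_depth B -> (fun k => fine (nu k B)) @ \oo --> fine (mu B).
  by move=> Bf; rewrite muE//; exact: cvg_nu.
have mui : invariant mu.
  apply: finite_depth_invariant => B Bf; rewrite !muE//; last exact: finite_depth_shift.
  have nuE : (fun k => fine (nu k B)) = (fun k => fine (nu k (shift @^-1` B))).
    by apply/funext => k; rewrite (nuP k).1//; exact: finite_depth_measurable.
  by rewrite /p nuE.
exists mu; apply/maximizingP => //; split=> //.
apply/eqP; rewrite eq_le le_max_integral//=.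
rewrite leNgt; apply/negP => lt_max.
have := @cvg_Rintegral _ _ _ _ _ _ nu mu f fc cvg_mu.
pose d := (max_integral f - \int[mu]_x f x) / 2.
have d0 : 0 < d by rewrite divr_gt0// subr_gt0.
move=> /cvgrPdist_lt/(_ d d0) nu_mu.
have [k [+ [_ +]]] := filter_ex (filterI nu_mu (near_nu d d0)).
by rewrite ltr_distl /d => /andP[h1 h2] h3; lra.
Qed.

Lemma measure_support_closed mu : closed (measure_support mu).
Proof.
rewrite -openC; apply/open_agree => x /existsNP[U /not_implyP[oU /not_implyP[Ux muU]]].
have /open_agree/(_ _ Ux)[n xU] := oU.
by exists n => y /xU Uy /(_ U oU Uy).
Qed.

Lemma measure_support_shift mu : invariant mu ->
  shift @` measure_support mu `<=` measure_support mu.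
Proof.
move=> mui _ [x xK <-] U oU Ux; rewrite -mui; last exact: open_sft_measurable.
by apply: xK => //; apply: open_comp => // y _; exact: continuous_shift.
Qed.

Lemma measure_support_measurable mu : measurable (measure_support mu).
Proof.
rewrite -[measure_support mu]setCK; apply: measurableC; apply: open_sft_measurable.
by rewrite openC; exact: measure_support_closed.
Qed.

(** The complement of the support is covered by countably many null sets of
    finite depth. *)
Lemma measure_support_full mu : mu (measure_support mu) = 1%E.
Proof.
have mK := measure_support_measurable mu.
have [||F [F0 KF]] := @countable_depth_cover _ _ _ _ _ _
    [set B | mu B = 0%E] (~` measure_support mu); first exact: measure0.
  move=> x /existsNP[U /not_implyP[oU /not_implyP[Ux /negP muU]]].
  have /open_agree/(_ _ Ux)[n xU] := oU.
  exists n; apply/eqP; rewrite eq_le measure_ge0 andbT.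
  rewrite -leNgt in muU; apply: le_trans muU; apply: le_measure; rewrite ?inE.
  - by apply: finite_depth_measurable; exists n; exact: agree_depth.
  - exact: open_sft_measurable.
  - exact: xU.
have FN : mu.-negligible (\bigcup_k F k).
  apply: negligible_bigcup => k; have [Fk Fk0] := F0 k.
  by apply/negligibleP => //; exact: finite_depth_measurable.
have /negligibleP h := negligibleS KF FN.
have := probability_setC mu (measurableC mK); rewrite setCK h ?sube0//.
exact: measurableC.
Qed.

End Maximization.

(** * Periodic orbits *)

Section PeriodicOrbits.
Context {R : realType} {S : finType} {M : rel S} {lam : R}.
Context {lam_gt1 : 1 < lam} {ne : exists x, admissible M x}.
Local Notation X := (sft lam_gt1 ne).
Local Notation shift := (@sft_shift R S M lam lam_gt1 ne).
Local Notation invariant := (Defs.invariant shift).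
Implicit Types (x y z p : X) (B C : set X) (f g : X -> R) (mu nu : probability X R).

(** Mixing yields words joining any two letters that occur; the alphabet being finite,
    their lengths are bounded uniformly. *)
Lemma mixing_connection : topologically_mixing shift ->
  exists N, forall x y, exists z k,
    [/\ (0 < k <= N)%N, z 0%N = x 0%N & z k = y 0%N].
Proof.
move=> mix.
have /choice[N NP] (ab : S * S) : exists N, forall x y, x 0%N = ab.1 -> y 0%N = ab.2 ->
    exists z k, [/\ (0 < k <= N)%N, z 0%N = x 0%N & z k = y 0%N].
  pose letter (s : S) : set X := [set x : X | x 0%N = s].
  have letter_open s : open (letter s).
    by apply/open_agree => x <-; exists 1%N => y xy; rewrite /letter/= xy.
  have [[x0 [y0 [xa yb]]]|none] :=
      pselect (exists x y : X, x 0%N = ab.1 /\ y 0%N = ab.2); last first.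
    by exists 0%N => x y xa yb; exfalso; apply: none; exists x, y.
  have [||N NP] := mix _ _ (letter_open ab.1) (letter_open ab.2).
  - by exists x0.
  - by exists y0.
  have [_ [[z za <-] zb]] := NP N.+1 (leqnSn N).
  exists N.+1 => x y xa' yb'; exists z, N.+1; split; [by rewrite leqnn|by rewrite xa'|].
  by rewrite yb'; have := zb; rewrite /letter/= iter_shiftE addn1.
exists (\max_(ab : S * S) N ab) => x y.
have [z [k [/andP[k0 kN] zx zy]]] := NP (x 0%N, y 0%N) x y erefl erefl.
exists z, k; split=> //; rewrite k0/= (leq_trans kN)//.
exact: (@leq_bigmax _ N).
Qed.

(** The word read along [y] is closed up into a loop by a connecting word from
    its last letter to its first one, and the loop is repeated. *)
Lemma periodic_shadowing N n y :
  (forall x y, exists z k, [/\ (0 < k <= N)%N, z 0%N = x 0%N & z k = y 0%N]) ->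
  exists p l, [/\ (l < N)%N, iter (n.+1 + l) shift p = p & agree n.+1 p y].
Proof.
move=> /(_ (iter n shift y) y)[z [[|l] [//= lN z0 zl]]].
rewrite iter_shiftE addn0 in z0.
(* The connecting word starts at the letter [y n], shared by both pieces. *)
pose q i := if (i < n.+1)%N then y i else z (i - n)%N.
have qM i : M (q i) (q i.+1).
  rewrite /q; case: ltnP => [i_n|n_i].
    rewrite ltnS leq_eqVlt in i_n; have [->|i_n'] := predU1P i_n.
      by rewrite ltnn subSnn -z0; exact: sft_admissible.
    by rewrite ltnS i_n'; exact: sft_admissible.
  by rewrite ltnNge (leqW n_i)/= subSn ?(ltnW n_i)//; exact: sft_admissible.
have qL : q (n.+1 + l)%N = q 0%N.
  rewrite /q/= ltnNge leq_addr/= addSnnS addKn.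
  by rewrite zl.
pose r i := q (i %% (n.+1 + l))%N.
have rM : admissible M r.
  move=> i; rewrite /r.
  have -> : (i.+1 %% (n.+1 + l) = (i %% (n.+1 + l)).+1 %% (n.+1 + l))%N.
    by rewrite -(addn1 (i %% _)) modnDml addn1.
  have : ((i %% (n.+1 + l))%N < n.+1 + l)%N by rewrite ltn_mod addSn.
  move: (i %% _)%N => j; rewrite leq_eqVlt => /predU1P[jE|jL].
    by rewrite jE modnn -qL -jE; exact: qM.
  by rewrite modn_small//; exact: qM.
exists (Sft lam_gt1 ne rM), l; split=> //.
  apply: sft_eq => i; rewrite (iter_shiftE (n.+1 + l)) [LHS]/= /r.
  by rewrite modnDl.
move=> i i_n /=; rewrite /r modn_small ?/q ?i_n//.
by rewrite (leq_trans i_n)// leq_addr.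
Qed.

Definition birkhoff f n x : R := \sum_(i < n) f (iter i shift x).

Lemma birkhoffSl f n x : birkhoff f n.+1 x = f x + birkhoff f n (shift x).
Proof.
rewrite /birkhoff big_ord_recl/=; congr +%R.
by apply: eq_bigr => i _; rewrite -iterSr.
Qed.

Lemma birkhoffSr f n x : birkhoff f n.+1 x = birkhoff f n x + f (iter n shift x).
Proof. by rewrite /birkhoff big_ord_recr. Qed.

Lemma birkhoffD f m n x :
  birkhoff f (m + n) x = birkhoff f m x + birkhoff f n (iter m shift x).
Proof.
elim: n => [|n IH]; first by rewrite addn0 /birkhoff big_ord0 addr0.
by rewrite addnS !birkhoffSr IH addrA -iterD addnC.
Qed.

(** The uniform measure on a periodic orbit is invariant. Its mass on sets of
    finite depth is an orbit average; the integral of [f] is then computed by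
    approximation with step functions. *)
Lemma periodic_birkhoff_le f p L : depth_continuous f -> (0 < L)%N ->
  iter L shift p = p -> birkhoff f L p <= L%:R * max_integral f.
Proof.
move=> fc L0 pL.
have L0' : 0 < L%:R :> R by rewrite ltr0n.
pose mean g := birkhoff g L p / L%:R.
have meanD g h : mean (fun x => g x + h x) = mean g + mean h.
  by rewrite /mean /birkhoff big_split/= mulrDl.
have [mu muE] : exists mu : probability X R,
    forall B, finite_depth B -> mu B = (mean \1_B)%:E.
  apply: finitely_additive_extension.
  - move=> B _; rewrite divr_ge0 ?ler0n//; apply: sumr_ge0 => i _.
    by rewrite indicE.
  - move=> B C _ _ /disj_set2P BC; rewrite -meanD; congr mean.
    apply/funext => x; rewrite !indicE in_setU.
    have := congr1 (fun D : set X => x \in D) BC; rewrite /= in_setI in_set0.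
    by case: (x \in B); case: (x \in C) => //=; rewrite ?addr0 ?add0r.
  - rewrite /mean /birkhoff; under eq_bigr do rewrite indicE in_setT.
    by rewrite sumr_const card_ord divff// gt_eqF.
have mui : invariant mu.
  apply: finite_depth_invariant => B Bf; rewrite !muE//; last exact: finite_depth_shift.
  congr EFin; rewrite /mean; congr (_ / _).
  have := birkhoffSr \1_B L p; rewrite birkhoffSl pL addrC => /addIr.
  move=> <-; rewrite /birkhoff; apply: eq_bigr => i _.
  by rewrite !indicE -iterSr.
have mu_mean : \int[mu]_x f x = mean f.
  apply/eqP; rewrite -subr_eq0 -normr_le0; apply/ler_addgt0Pl => e e0; rewrite addr0.
  have [n fn] := fc (e / 2) (divr_gt0 e0 (ltr0Sn R 1)).
  have sd := step_fun_dist fn.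
  have stc := depth_continuous_step n f.
  have muS : \int[mu]_x step_fun n f x = mean (step_fun n f).
    rewrite Rintegral_step /mean /birkhoff.
    under [in RHS]eq_bigr do rewrite step_funE.
    rewrite exchange_big/= mulr_suml; apply: eq_bigr => w _.
    rewrite muE; last by exists n; exact: cylinder_depth.
    by rewrite /= /mean /birkhoff -mulr_sumr mulrA.
  have meanS : `|mean f - mean (step_fun n f)| <= e / 2.
    rewrite /mean -mulrBl normrM normfV [`|L%:R|]gtr0_norm// ler_pdivrMr//.
    rewrite /birkhoff -sumrB (le_trans (ler_norm_sum _ _ _))//.
    rewrite (@le_trans _ _ (\sum_(i < L) (e / 2)))//; first exact: ler_sum.
    by rewrite sumr_const card_ord mulr_natr.
  have := Rintegral_dist mu fc stc sd; rewrite muS.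
  move: meanS; rewrite !ler_norml => /andP[h1 h2] /andP[h3 h4].
  by apply/andP; split; lra.
by rewrite mulrC -ler_pdivrMr// -[leLHS]mu_mean le_max_integral.
Qed.

End PeriodicOrbits.

(** * Sub-actions *)

Section SubAction.
Context {R : realType} {S : finType} {M : rel S} {lam : R}.
Context {lam_gt1 : 1 < lam} {ne : exists x, admissible M x}.
Local Notation X := (sft lam_gt1 ne).
Local Notation shift := (@sft_shift R S M lam lam_gt1 ne).
Local Notation invariant := (Defs.invariant shift).
Implicit Types (x y z p : X) (B C : set X) (f g : X -> R) (mu nu : probability X R).

(** The form in which the Hölder condition is used; [theta] is
    [lam] to the power [- alpha]. *)
Definition exponential_variation f H theta :=
  [/\ 0 <= H, 0 <= theta < 1 &
      forall n x y, agree n x y -> `|f x - f y| <= H * theta ^+ n].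

Lemma geometric_small (H theta e : R) : 0 <= H -> 0 <= theta < 1 -> 0 < e ->
  exists n, H * theta ^+ n <= e.
Proof.
move=> H0 /andP[t0 t1] e0.
have : (fun n => H * theta ^+ n) @ \oo --> H * 0.
  by apply: cvgMl_tmp; apply: cvg_expr; rewrite ger0_norm.
rewrite mulr0 => /cvgrPdist_le/(_ _ e0)[n _ /(_ n (leqnn n))] /=.
rewrite sub0r normrN ger0_norm ?mulr_ge0 ?exprn_ge0// => h.
by exists n.
Qed.

Lemma exponential_variation_continuous f H theta :
  exponential_variation f H theta -> depth_continuous f.
Proof.
move=> [H0 t01 fH] e e0; have [n small] := geometric_small H0 t01 e0.
by exists n => x y /fH h; exact: le_trans small.
Qed.

(** The variations of [f] along two orbit segments that stay close form a
    geometric series, so distortion is bounded independently of [n]. *)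
Lemma birkhoff_variation f H theta : exponential_variation f H theta ->
  forall n m x y, agree (n + m) x y ->
    `|birkhoff f n x - birkhoff f n y| <= H / (1 - theta) * theta ^+ m.
Proof.
move=> [H0 /andP[t0 t1] fH] n m x y xy.
have u0 : 0 < 1 - theta by rewrite subr_gt0.
(* The sharper bound, a partial geometric sum, is what passes through the
   induction. *)
suff : `|birkhoff f n x - birkhoff f n y| <=
    H / (1 - theta) * theta ^+ m * (1 - theta ^+ n.+1).
  move=> /le_trans; apply; rewrite ler_piMr//.
    by rewrite !mulr_ge0 ?invr_ge0 ?exprn_ge0 ?(ltW u0).
  by rewrite gerBl exprn_ge0.
elim: n x y xy => [|n IH] x y xy.
  rewrite /birkhoff !big_ord0 subrr normr0 !mulr_ge0 ?invr_ge0 ?exprn_ge0 ?(ltW u0)//.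
rewrite !birkhoffSl opprD addrACA (le_trans (ler_normD _ _))//.
have xy' : agree (n + m) (shift x) (shift y) by move=> i lin; exact: xy.
apply: (le_trans (lerD (fH _ _ _ xy) (IH _ _ xy'))).
rewrite le_eqVlt; apply/orP; left; apply/eqP.
rewrite !addSn !exprS exprD; field.
by rewrite gt_eqF.
Qed.

(** An orbit segment is shadowed by a periodic orbit that is longer by a bounded
    amount, and a periodic orbit has nonpositive sum once [f] is normalized. *)
Lemma birkhoff_bounded f H theta : topologically_mixing shift ->
  exponential_variation f H theta ->
  exists K, forall n x, birkhoff f n x - n%:R * max_integral f <= K.
Proof.
move=> mix fv; have fc := exponential_variation_continuous fv.
have [N conn] := mixing_connection mix.
have [F fF] := depth_continuous_bounded fc.
set m := max_integral f; pose C := H / (1 - theta).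
have C0 : 0 <= C.
  case: fv => H0 /andP[_ t1] _.
  by rewrite /C mulr_ge0// invr_ge0 subr_ge0 ltW.
have F0 : 0 <= F by have [x0 x0M] := ne; exact: le_trans (fF (Sft lam_gt1 ne x0M)).
exists (N%:R * (`|m| + F) + C) => -[|n] y.
  rewrite /birkhoff big_ord0 mul0r subr0.
  by rewrite addr_ge0// mulr_ge0// addr_ge0.
have [p [l [lN pL py]]] := periodic_shadowing n y conn.
have := periodic_birkhoff_le fc _ pL; rewrite addSn => /(_ isT).
rewrite -addSn birkhoffD natrD mulrDl => h1.
have := @birkhoff_variation f H theta fv n.+1 0 p y.
rewrite addn0 expr0 mulr1 => /(_ py); rewrite ler_distl => /andP[h2 _].
have h3 : `|birkhoff f l (iter n.+1 shift p)| <= l%:R * F.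
  rewrite /birkhoff (le_trans (ler_norm_sum _ _ _))//.
  rewrite (@le_trans _ _ (\sum_(i < l) F))//; first by apply: ler_sum => i _; exact: fF.
  by rewrite sumr_const card_ord mulr_natl.
move: h3; rewrite ler_norml => /andP[h3 _].
have h4 : l%:R * m <= l%:R * `|m| by rewrite ler_wpM2l// ler_norm.
have h5 : l%:R * (`|m| + F) <= N%:R * (`|m| + F).
  by rewrite ler_wpM2r ?addr_ge0// ler_nat ltnW.
rewrite -/C in h2; rewrite -/m in h1; lra.
Qed.

(** The transition condition only involves consecutive letters, so the past of
    a point can be glued to another point with the same first letter. *)
Lemma transplant n y x : x 0%N = y n ->
  exists y', [/\ forall i, (i < n)%N -> y' i = y i & iter n shift y' = x].
Proof.
move=> xy; pose q i := if (i < n)%N then y i else x (i - n)%N.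
have qM : admissible M q.
  move=> i; rewrite /q; case: (ltnP i n) => [i_n|n_i].
    case: (ltnP i.+1 n) => [_|n_i]; first exact: sft_admissible.
    have -> : n = i.+1 by apply/eqP; rewrite eqn_leq n_i.
    move: xy; have -> : n = i.+1 by apply/eqP; rewrite eqn_leq n_i.
    by rewrite subnn => ->; exact: sft_admissible.
  by rewrite ltnNge (leqW n_i)/= subSn//; exact: sft_admissible.
exists (Sft lam_gt1 ne qM); split.
  by move=> i i_n /=; rewrite /q i_n.
apply: sft_eq => i; rewrite (iter_shiftE n) /= /q.
by rewrite ltnNge leq_addr/= addKn.
Qed.

(** The supremum of these sums is the best gain over the finite pasts of [x],
    the empty one included. *)
Definition history_sums f x : set R :=
  [set birkhoff f ny.1 ny.2 - ny.1%:R * max_integral f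
    | ny in [set ny : nat * X | iter ny.1 shift ny.2 = x]].

Definition sub_action f x : R := sup (history_sums f x).

(** Extending a past of [x] by one step gives a past of [shift x], which is the
    inequality. For continuity, nearby points have the same pasts up to a change
    of the common endpoint, and the corresponding sums are close by bounded
    distortion. *)
Theorem sub_actionP f H theta : topologically_mixing shift ->
  exponential_variation f H theta ->
  depth_continuous (sub_action f) /\
  forall x, f x + sub_action f x - sub_action f (shift x) <= max_integral f.
Proof.
move=> mix fv; have [K fK] := birkhoff_bounded mix fv.
have hs x : has_sup (history_sums f x).
  split; first by exists (birkhoff f 0 x - 0%:R * max_integral f), (0%N, x).
  by exists K => _ [[n y] /= _ <-]; exact: fK.
have ub x n y : iter n shift y = x ->
    birkhoff f n y - n%:R * max_integral f <= sub_action f x.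
  by move=> yx; apply: (sup_upper_bound (hs x)); exists (n, y).
have lb x c : (forall n y, iter n shift y = x ->
    birkhoff f n y - n%:R * max_integral f <= c) -> sub_action f x <= c.
  move=> xc; apply: ge_sup; first exact: (hs x).1.
  by move=> _ [[n y] /= yx <-]; exact: xc.
split; last first.
  move=> x; rewrite lerBlDl addrC -lerBrDr; apply: lb => n y yx.
  rewrite lerBrDr.
  have := ub (shift x) n.+1 y; rewrite iterS yx => /(_ erefl).
  rewrite birkhoffSr yx -natr1; lra.
move=> e e0; have [H0 t01 _] := fv.
have C0 : 0 <= H / (1 - theta).
  by case/andP: t01 => _ t1; rewrite mulr_ge0// invr_ge0 subr_ge0 ltW.
have [n He] := geometric_small C0 t01 e0.
have half x x' : agree n.+1 x x' -> sub_action f x <= sub_action f x' + e.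
  move=> xx'; apply: lb => k y yx.
  have x'y : x' 0%N = y k by rewrite -xx'// -yx iter_shiftE addn0.
  have [y' [y'y y'x]] := transplant x'y.
  have yy' : agree (k + n.+1) y y'.
    move=> i; case: (ltnP i k) => [/y'y//|ki] ikn.
    rewrite -(subnKC ki) -!iter_shiftE yx y'x; apply: xx'.
    by rewrite ltn_subLR.
  have := ub _ _ _ y'x.
  have := birkhoff_variation fv (agree_le _ yy' : agree (k + n) y y').
  rewrite leq_add2l leqnSn => /(_ isT).
  rewrite ler_distl => /andP[_ h1] h2; lra.
exists n.+1 => x x' xx'; rewrite ler_distl; apply/andP; split.
  by rewrite lerBlDr; apply: half; exact: agree_sym.
exact: half.
Qed.

(** The function [g = m - f + V o shift - V] is nonnegative and continuous, and
    its integral against an invariant measure [eta] is [m] minus the integral of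
    [f]. It has zero integral against [mu], so it vanishes on the support. *)
Lemma support_maximizing f H theta mu nu : topologically_mixing shift ->
  exponential_variation f H theta -> maximizing shift f mu ->
  invariant nu -> nu (measure_support mu) = 1%E -> maximizing shift f nu.
Proof.
move=> mix fv mumax nui nuK; have fc := exponential_variation_continuous fv.
have [Vc VP] := sub_actionP mix fv.
set V := sub_action f in Vc VP; set m := max_integral f in VP.
pose g x := (m - f x) + (V (shift x) - V x).
have Vsc : depth_continuous (fun x => V (shift x)) := depth_continuous_shift Vc.
have mfc : depth_continuous (fun x => m - f x).
  exact: depth_continuousB (depth_continuous_cst m) fc.
have Wc : depth_continuous (fun x => V (shift x) - V x) := depth_continuousB Vsc Vc.
have gc : depth_continuous g := depth_continuousD mfc Wc.
have g0 x : 0 <= g x by have := VP x; rewrite /g; lra.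
have gE (eta : probability X R) : invariant eta ->
    \int[eta]_x g x = m - \int[eta]_x f x.
  move=> etai; rewrite /g RintegralD//; try exact: depth_continuous_integrable.
  rewrite !RintegralB//; try exact: depth_continuous_integrable.
    by rewrite Rintegral_cst1 Rintegral_shift// subrr addr0.
  exact/depth_continuous_integrable/depth_continuous_cst.
have [mui muE] := (maximizingP _ fc).1 mumax.
(* Where [g] is positive it is bounded below on a neighbourhood, which has
   positive mass if the point is in the support. *)
have gK x : measure_support mu x -> g x = 0.
  move=> xK; apply/eqP; rewrite eq_le g0 andbT leNgt; apply/negP => gx.
  have gx2 : 0 < g x / 2 by rewrite divr_gt0.
  have [n gn] := gc _ gx2.
  pose B : set X := agree n x.
  have Bf : finite_depth B by exists n; exact: agree_depth.
  have mB := finite_depth_measurable Bf.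
  have muB : 0 < fine (mu B).
    rewrite fine_gt0//; apply/andP; split; last by rewrite ltey_eq fin_num_measure.
    by apply: xK => //; exact: finite_depth_open.
  have := gE _ mui; rewrite muE subrr => gmu0.
  have : \int[mu]_y (g x / 2 * \1_B y) <= \int[mu]_y g y.
    apply: le_Rintegral => //; try exact: depth_continuous_integrable.
      exact/depth_continuous_integrable/depth_continuousZ/depth_continuous_indic.
    move=> y _; rewrite indicE; case: (boolP (y \in B)) => yB; last by rewrite mulr0.
    rewrite mulr1; have /gn : agree n x y by rewrite inE in yB.
    rewrite ler_distl => /andP[_ h]; lra.
  rewrite RintegralZl// ?Rintegral_indic// ?gmu0; last first.
    exact/depth_continuous_integrable/depth_continuous_indic.
  by rewrite leNgt mulr_gt0.
apply/maximizingP => //; split=> //.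
apply/esym/eqP; rewrite -subr_eq0 -/m -gE//; apply/eqP.
have mK := measure_support_measurable mu.
rewrite /Rintegral (@ae_eq_integral _ _ _ nu setT (cst 0%E))//.
- by rewrite integral_cst// mul0e.
- by apply/measurable_EFinP; exact: depth_continuous_measurable.
exists (~` measure_support mu); split; first exact: measurableC.
  by have := probability_setC nu mK; rewrite nuK subee.
by move=> x /= h xK; apply: h => _; rewrite /= gK.
Qed.

End SubAction.

(** * Perturbation of potentials and pressure *)

Section Perturbation.
Context {R : realType} {S : finType} {M : rel S} {lam : R}.
Context {lam_gt1 : 1 < lam} {ne : exists x, admissible M x}.
Local Notation X := (sft lam_gt1 ne).
Local Notation shift := (@sft_shift R S M lam lam_gt1 ne).
Local Notation invariant := (Defs.invariant shift).
Implicit Types (B : set X) (f g : X -> R) (mu nu : probability X R).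

Lemma le_Rintegral_add mu f g c : depth_continuous f -> depth_continuous g ->
  (forall x, f x <= g x + c) -> \int[mu]_x f x <= \int[mu]_x g x + c.
Proof.
move=> fc gc fg.
have cc := @depth_continuous_cst _ _ _ _ lam_gt1 ne c.
rewrite -[X in _ + X](Rintegral_cst1 mu c) -RintegralD//;
  try exact: depth_continuous_integrable.
apply: le_Rintegral => //; try exact: depth_continuous_integrable.
exact/depth_continuous_integrable/depth_continuousD.
Qed.

Lemma max_integral_le f g c mu : invariant mu ->
  depth_continuous f -> depth_continuous g ->
  (forall x, f x <= g x + c) -> max_integral f <= max_integral g + c.
Proof.
move=> mui fc gc fg; apply: ge_sup; first by exists (\int[mu]_x f x), mu.
move=> _ [nu nui <-]; apply: (le_trans (le_Rintegral_add nu fc gc fg)).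
by rewrite lerD2r le_max_integral.
Qed.

Lemma near_maximizing_dist f g d mu : depth_continuous f -> depth_continuous g ->
  (forall x, `|f x - g x| <= d) -> near_maximizing f d mu ->
  near_maximizing g (3 * d) mu.
Proof.
move=> fc gc fg [mui mud]; split=> //.
have gf x : g x <= f x + d by have := fg x; rewrite ler_distl => /andP[]; lra.
have fg' x : f x <= g x + d by have := fg x; rewrite ler_distl => /andP[]; lra.
have := max_integral_le mui gc fc gf; have := le_Rintegral_add mu fc gc fg'.
lra.
Qed.

Lemma concentrated_open f B e : depth_continuous f -> concentrated f B e ->
  exists2 r, 0 < r & forall g, depth_continuous g ->
    (forall x, `|f x - g x| <= r) -> concentrated g B e.
Proof.
move=> fc [d d0 fd]; exists (d / 3); first by rewrite divr_gt0.
move=> g gc fg; exists (d / 3); first by rewrite divr_gt0.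
have fgC x : `|g x - f x| <= d / 3 by rewrite distrC.
have dE : 3 * (d / 3) = d by field.
by move=> mu nu mud nud; apply: fd; rewrite -dE;
  apply: near_maximizing_dist fgC _.
Qed.

Lemma near_maximizing_cst f c d mu : depth_continuous f ->
  near_maximizing (fun x => f x + c) d mu -> near_maximizing f d mu.
Proof.
move=> fc [mui].
have cc := @depth_continuous_cst _ _ _ _ lam_gt1 ne c.
have fcc := depth_continuousD fc cc.
rewrite RintegralD ?Rintegral_cst1//; try exact: depth_continuous_integrable.
move=> h; split=> //.
have fE x : f x <= f x + c + - c by rewrite addrK.
have := max_integral_le mui fc fcc fE; lra.
Qed.

Lemma concentrated_cst f c B e : depth_continuous f -> concentrated f B e ->
  concentrated (fun x => f x + c) B e.
Proof.
move=> fc [d d0 fd]; exists d => // mu nu /(near_maximizing_cst fc) mud.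
by move=> /(near_maximizing_cst fc); exact: fd.
Qed.

(** Each measure is nearly optimal for its own parameter; comparing it there with
    the other one and adding the two inequalities cancels the integrals of
    [f]. *)
Lemma near_maximizing_monotone f B d s t mu nu : depth_continuous f ->
  finite_depth B ->
  near_maximizing (fun x => f x + t * \1_B x) d mu ->
  near_maximizing (fun x => f x + s * \1_B x) d nu ->
  - (2 * d) < (s - t) * (fine (nu B) - fine (mu B)).
Proof.
move=> fc Bf [mui mud] [nui nud].
have Bc := depth_continuous_indic Bf.
have ftc u : depth_continuous (fun x => f x + u * \1_B x).
  exact: depth_continuousD fc (depth_continuousZ u Bc).
have IE (eta : probability X R) u : \int[eta]_x (f x + u * \1_B x) =
    \int[eta]_x f x + u * fine (eta B).
  have uc := depth_continuousZ u Bc.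
  rewrite RintegralD//; try exact: depth_continuous_integrable.
  rewrite RintegralZl//; last exact: depth_continuous_integrable.
  by rewrite Rintegral_indic//; exact: finite_depth_measurable.
have := le_max_integral (ftc t) nui; have := le_max_integral (ftc s) mui.
move: mud nud; rewrite !IE; lra.
Qed.

(** If concentration failed for all parameters below [r], the mass of [B] would
    grow by at least [e / 2] at each of the equally spaced parameters
    [t 0, ..., t N.+1], and would exceed 1 at the last one. *)
Lemma concentrated_dense f B e r : depth_continuous f -> finite_depth B ->
  0 < e -> 0 < r -> (exists mu : probability X R, invariant mu) ->
  exists t, 0 < t < r /\ concentrated (fun x => f x + t * \1_B x) B e.
Proof.
move=> fc Bf e0 r0 exi; apply: contrapT => /forallNP noconc.
have mB := finite_depth_measurable Bf.
pose N := Num.truncn (2 / e).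
have N_large : 1 < N.+1%:R * (e / 2).
  have : 2 / e < N.+1%:R by exact: truncnS_gt.
  by rewrite ltr_pdivrMr// mulrA ltr_pdivlMr// mul1r.
pose eta := r / N.+3%:R.
have eta0 : 0 < eta by rewrite divr_gt0.
(* Consecutive parameters differ by [eta], so near-optimality up to [delta]
   costs at most [2 * delta / eta = e / 4] of monotonicity. *)
pose delta := eta * e / 8.
have delta0 : 0 < delta by rewrite !mulr_gt0 ?invr_gt0.
pose t j : R := j.+1%:R * eta.
have tr j : (j <= N.+1)%N -> 0 < t j < r.
  move=> jN; rewrite mulr_gt0//= /t /eta mulrCA gtr_pMr//.
  by rewrite ltr_pdivrMr// mul1r ltr_nat ltnS.
pose F j x := f x + t j * \1_B x.
have spread j : (j <= N.+1)%N -> exists mu nu, [/\ near_maximizing (F j) delta mu,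
    near_maximizing (F j) delta nu & fine (mu B) + e <= fine (nu B)].
  move=> jN; have /not_andP[//|] := noconc (t j); first by rewrite tr.
  move=> /forall2NP/(_ delta)[//|] /existsNP[mu] /existsNP[nu].
  move=> /not_implyP[mud] /not_implyP[nud] /negP; rewrite -leNgt.
  have [le_mn|lt_nm] := leP (fine (mu B)) (fine (nu B)).
    by rewrite distrC ger0_norm ?subr_ge0// => h; exists mu, nu; split=> //; lra.
  by rewrite gtr0_norm ?subr_gt0// => h; exists nu, mu; split=> //; lra.
have mass j nu : (j <= N.+1)%N -> near_maximizing (F j) delta nu ->
    j%:R * (e / 2) <= fine (nu B).
  elim: j nu => [|j IH] nu jN nud; first by rewrite mul0r fine_ge0.
  have [mu [nu' [mud nud' h]]] := spread j (ltnW jN).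
  have := near_maximizing_monotone fc Bf nud' nud.
  have -> : t j.+1 - t j = eta by rewrite /t -mulrBl -natrB// subSnn mul1r.
  have := IH mu (ltnW jN) mud.
  have -> : j.+1%:R * (e / 2) = j%:R * (e / 2) + e / 2.
    by rewrite -[j.+1%:R]natr1 mulrDl mul1r.
  have -> : - (2 * delta) = eta * - (e / 4) by rewrite /delta; field.
  rewrite ltr_pM2l//; lra.
have [mu [_ [mud _ _]]] := spread N.+1 (leqnn _).
have := mass _ _ (leqnn _) mud.
have : fine (mu B) <= 1.
  by rewrite -lee_fin fineK ?fin_num_measure// probability_le1.
lra.
Qed.

Lemma pressure_le f g c : depth_continuous f -> depth_continuous g ->
  (forall x, f x <= g x + c) ->
  (pressure shift f <= pressure shift g + c%:E)%E.
Proof.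
move=> fc gc fg; apply: ge_ereal_sup => _ [mu mui <-].
apply: (@le_trans _ _ ((metric_entropy shift mu + \int[mu]_x (g x)%:E) + c%:E)%E).
  rewrite -addeA leeD2l// !integral_EFin// -EFinD lee_fin.
  exact: le_Rintegral_add.
by rewrite leeD2r//; apply: ereal_sup_ubound; exists mu.
Qed.

(** The supremum of the empty set is [-oo]. *)
Lemma pressure_fin_invariant f : (pressure shift f > -oo)%E ->
  exists mu : probability X R, invariant mu.
Proof.
move=> f_noo; apply: contrapT => noinv; move: f_noo; rewrite /pressure.
rewrite (_ : [set _ | _ in _] = set0) ?ereal_sup0//.
by apply/seteqP; split=> // h [mu mui _]; apply: noinv; exists mu.
Qed.

(** The constant is the opposite of the pressure of [g], which is finite because
    [g] is uniformly close to a potential of zero pressure. *)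
Lemma pressure_normalize f g e : depth_continuous f -> depth_continuous g ->
  pressure shift f = 0%E -> (forall x, `|f x - g x| <= e) ->
  exists2 c, `|c| <= e & pressure shift (fun x => g x + c) = 0%E.
Proof.
move=> fc gc f0 fg.
have gf x : g x <= f x + e by have := fg x; rewrite ler_distl => /andP[]; lra.
have fg' x : f x <= g x + e by have := fg x; rewrite ler_distl => /andP[]; lra.
have := pressure_le gc fc gf; have := pressure_le fc gc fg'.
rewrite f0 add0e; case pE : (pressure shift g) => [p| |]//.
rewrite -EFinD !lee_fin => h1 h2.
exists (- p); first by rewrite normrN ler_norml; apply/andP; split; lra.
have gpc : depth_continuous (fun x => g x + - p).
  exact: depth_continuousD gc (depth_continuous_cst _).
apply/eqP; rewrite eq_le; apply/andP; split.
  have := @pressure_le (fun x => g x + - p) g (- p) gpc gc (fun=> lexx _).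
  by rewrite pE -EFinD subrr.
have gE x : g x <= g x + - p + p by rewrite subrK.
by have := pressure_le gc gpc gE; rewrite pE -leeBlDr// -EFinB subrr.
Qed.

End Perturbation.

(** * Hölder potentials of zero pressure *)

Section HolderOnSubshift.
Context {R : realType} {S : finType} {M : rel S} {lam : R}.
Context {lam_gt1 : 1 < lam} {ne : exists x, admissible M x}.
Local Notation X := (sft lam_gt1 ne).
Local Notation shift := (@sft_shift R S M lam lam_gt1 ne).
Variable alpha : R.
Hypothesis alpha_gt0 : 0 < alpha.
Local Notation holder := (holder X alpha).
Implicit Types (B : set X) (A : holder).

Let lam0 : 0 < lam. Proof. exact: lt_trans lam_gt1. Qed.

Lemma powR_lamV n : (lam ^- n) `^ alpha = (lam^-1 `^ alpha) ^+ n.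
Proof.
have l0 : 0 <= lam^-1 by rewrite invr_ge0 ltW.
by rewrite -exprVn -(powR_mulrn n l0) powRAC powR_mulrn ?powR_ge0.
Qed.

Lemma holder_exponential_variation A :
  exponential_variation A (Hold alpha A) (lam^-1 `^ alpha).
Proof.
have l0 : 0 <= lam^-1 by rewrite invr_ge0 ltW.
split; first exact: Hold_ge0 (holderP A).
  have : lam^-1 `^ alpha < 1 `^ alpha.
    by rewrite gt0_ltr_powR ?nnegrE// invf_lt1.
  by rewrite powR1 powR_ge0.
move=> n x y xy; have [->|xy0] := eqVneq x y.
  rewrite subrr normr0 mulr_ge0 ?exprn_ge0 ?powR_ge0//.
  exact: Hold_ge0 (holderP A).
have d0 : 0 < mdist x y by rewrite mdist_gt0.
have := Hold_ub (holderP A) (introT andP (conj d0 (mdist_le1 x y))).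
rewrite ler_pdivrMr ?powR_gt0// => /le_trans; apply.
rewrite ler_wpM2l//; first exact: Hold_ge0 (holderP A).
have ln0 : 0 <= lam ^- n by rewrite invr_ge0 exprn_ge0// ltW.
rewrite -powR_lamV ge0_ler_powR ?nnegrE ?mdist_ge0 ?(ltW alpha_gt0)//.
exact: mdist_agree.
Qed.

Lemma holder_continuous A : depth_continuous A.
Proof. exact: exponential_variation_continuous (holder_exponential_variation A). Qed.

Lemma holder_dist A A' x : `|A x - A' x| <= `|A - A'|.
Proof.
apply: le_trans (_ : norm0 (A - A' : holder) <= _).
  exact: norm0_ub (holderP (A - A')).
by rewrite lerDr; exact: Hold_ge0 (holderP (A - A')).
Qed.

Lemma is_holder_cst (c : R) : (fun=> c) \in is_holder (T := X) alpha.
Proof.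
apply/is_holderP; split.
  by exists 0 => _ [x [y [_ ->]]]; rewrite subrr normr0 mul0r.
by exists `|c| => _ [x _ <-].
Qed.

Definition holder_cst c : holder := Holder (is_holder_cst c).

Lemma norm_holder_cst c : `|holder_cst c| <= `|c|.
Proof.
rewrite -[leRHS]add0r; apply: lerD; apply: sup_le_nneg => //.
  by move=> _ [x [y [_ ->]]] /=; rewrite subrr normr0 mul0r.
by move=> _ [x _ <-].
Qed.

(** The quotient is 0 at distances below [lam ^- n], where the indicator is
    constant. *)
Lemma is_holder_indic B : finite_depth B -> \1_B \in is_holder (T := X) alpha.
Proof.
move=> [n Bn]; have n0 : 0 < lam ^- n by rewrite invr_gt0 exprn_gt0.
apply/is_holderP; split; last first.
  by exists 1 => _ [x _ <-]; rewrite indicE; case: (_ \in _); rewrite ?normr1 ?normr0.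
exists (((lam ^- n) `^ alpha)^-1) => _ [x [y [/andP[d0 _] ->]]].
have [dn|nd] := ltP (mdist x y) (lam ^- n).
  have xy := agree_le (leqnSn n) (agree_mdist dn).
  have -> : \1_B x = \1_B y :> R.
    rewrite !indicE; congr (_%:R); congr nat_of_bool.
    by apply/idP/idP; rewrite !inE; apply: Bn => //; exact: agree_sym.
  by rewrite subrr normr0 mul0r invr_ge0 powR_ge0.
apply: (@le_trans _ _ (1 / mdist x y `^ alpha)).
  rewrite ler_wpM2r ?invr_ge0 ?powR_ge0// !indicE.
  by case: (_ \in _); case: (_ \in _);
    rewrite ?subrr ?subr0 ?sub0r ?normrN ?normr1 ?normr0.
rewrite mul1r lef_pV2 ?posrE ?powR_gt0//.
by rewrite ge0_ler_powR ?nnegrE ?mdist_ge0 ?(ltW alpha_gt0) ?(ltW n0).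
Qed.

Definition holder_indic B (Bf : finite_depth B) : holder := Holder (is_holder_indic Bf).

Lemma holder0_invariant (A : holder0 lam_gt1 ne alpha) :
  exists mu : probability X R, Defs.invariant shift mu.
Proof.
case: A => A /set_mem A0; apply: (@pressure_fin_invariant _ _ _ _ _ _ A).
by rewrite A0.
Qed.

Definition concentrated_set B e : set (holder0 lam_gt1 ne alpha) :=
  [set A : holder0 lam_gt1 ne alpha | concentrated (\val A : holder) B e].

Lemma concentrated_set_open B e : open (concentrated_set B e).
Proof.
exists [set A : holder | concentrated A B e] => //.
rewrite openE => A /= AB; have [r r0 h] := concentrated_open (holder_continuous A) AB.
apply/nbhs_ballP; exists r => //= A'; rewrite -ball_normE/= => AA'.
apply: h; first exact: holder_continuous.
by move=> x; rewrite (le_trans (holder_dist A A' x))// ltW.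
Qed.

(** A small multiple of the indicator of [B] is added, then a constant that
    restores zero pressure and is no larger than that multiple. *)
Lemma concentrated_set_dense B e : finite_depth B -> 0 < e ->
  dense (concentrated_set B e).
Proof.
move=> Bf e0 O [A UA] [U oU UE]; rewrite -UE in UA *.
have exi := holder0_invariant A.
case: A UA => A A0 /= UA.
move: oU; rewrite openE => /(_ _ UA)/nbhs_ballP[r /= r0 rU].
pose I := holder_indic Bf.
have I0 : 0 < `|I| + 1 by rewrite ltr_wpDl.
have q0 : 0 < r / (2 * (`|I| + 1)) by rewrite divr_gt0// mulr_gt0.
have [t [/andP[t0 tq] conc]] := concentrated_dense (holder_continuous A) Bf e0 q0 exi.
pose A1 : holder := A + t *: I.
have A1E : A1 = (fun x => A x + t * \1_B x) :> (X -> R) by [].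
have tI : t * `|I| < r / 2.
  rewrite (@le_lt_trans _ _ (t * (`|I| + 1)))//; first by rewrite ler_wpM2l ?ltW// ltrDl.
  by rewrite -ltr_pdivlMr// -mulrA -invfM.
have [c ct Pc] : exists2 c, `|c| <= t * `|I| & pressure shift (fun x => A1 x + c) = 0%E.
  apply: (pressure_normalize (holder_continuous A) (holder_continuous A1)).
    exact: set_mem A0.
  move=> x; rewrite (le_trans (holder_dist A A1 x))// /A1 opprD addrA subrr sub0r.
  by rewrite normrN normrZ gtr0_norm.
pose A2 : holder := A1 + holder_cst c.
have A2E : A2 = (fun x => A1 x + c) :> (X -> R) by [].
have A2_0 : A2 \in (holder0 lam_gt1 ne alpha : set holder).
  by rewrite inE; exact: Pc.
exists (exist _ A2 A2_0); split=> /=.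
  apply: rU; rewrite -ball_normE/= /A2 /A1 !opprD !addrA subrr sub0r -opprD normrN.
  rewrite (le_lt_trans (ler_normD _ _))// normrZ (gtr0_norm t0).
  have := norm_holder_cst c; lra.
rewrite -[concentrated_set _ _ _]/(concentrated (fun x => A1 x + c) B e).
apply: concentrated_cst => //.
apply: depth_continuousD (holder_continuous A) _.
exact/depth_continuousZ/depth_continuous_indic.
Qed.

End HolderOnSubshift.
Unset Implicit Arguments.
Set Strict Implicit.
Set Printing Implicit Defensive.

Theorem theoremA (R : realType) (S : finType) (M : rel S)
    (lam : R) (lam_gt1 : 1 < lam) (ne : exists x, admissible M x)
    (mixing : topologically_mixing (@sft_shift R S M lam lam_gt1 ne))
    (alpha : R) (alpha_gt0 : 0 < alpha) (alpha_le1 : alpha <= 1) :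
  exists G1 : set (holder0 lam_gt1 ne alpha),
    generic_set G1 /\
    forall A, G1 A ->
      exists mu, [/\ maximizing sft_shift (\val A) mu,
                     forall nu, maximizing sft_shift (\val A) nu ->
                       same_measure nu mu &
                     uniquely_ergodic (measure_support mu)].
Proof.
pose test := ({n : nat & {set n.-tuple S}} * nat)%type.
pose F k : set (holder0 lam_gt1 ne alpha) :=
  if (unpickle k : option test) is Some cj
  then concentrated_set (code_set cj.1) cj.2.+1%:R^-1 else setT.
exists (\bigcap_k F k); split.
  exists (\bigcap_k F k) => //; exists F => // k; rewrite /F.
  case: unpickle => [[c j]|]; last first.
    split; first exact: openT.
    by move=> O [A OA] _; exists A.
  split; first exact: concentrated_set_open.
  apply: concentrated_set_dense => //.
  by exists (projT1 c); exact: code_set_depth.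
move=> A GA; have fc := holder_continuous alpha_gt0 (\val A).
have conc B e : finite_depth B -> 0 < e -> concentrated (\val A) B e.
  move=> [n /depth_set_code[D ->]] e0.
  have [j _ jd] := (@cvgrPdist_lt _ _ _ _ _ _ _).1 (@cvg_harmonic R) _ e0.
  have := jd j (leqnn j); rewrite /= sub0r normrN ger0_norm// => je.
  have := GA (pickle ((existT _ n D, j) : test)) I; rewrite /F pickleK.
  move=> [d d0 h]; exists d => // mu nu mud nud.
  exact: lt_trans (h _ _ mud nud) je.
have [mu mumax] := concentrated_exists fc (holder0_invariant A) conc.
have mui := ((maximizingP _ fc).1 mumax).1.
have uniq nu : maximizing sft_shift (\val A) nu -> same_measure nu mu.
  by move=> numax; exact: concentrated_unique fc conc numax mumax.
exists mu; split=> //; split.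
- exact: measure_support_closed.
- exact: measure_support_shift.
- exists mu; split; first by split=> //; exact: measure_support_full.
  move=> nu [nui nuK]; apply: uniq.
  exact: support_maximizing mixing (holder_exponential_variation alpha_gt0 _) mumax nui nuK.
Qed.
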